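(* Let $\Delta$ be the open unit disc in $\mathbb{C}$ and let $K$ be a compact subset of $\Delta$. Then there is a Swiss cheese set $X$ with $K\subseteq X$ such that every point of $X\setminus K$ is both a point of continuity and an R-point for $R(X)$, but such that for every closed line segment $I$ contained in $K$, every $f\in R(X)$ is infinitely differentiable on $I$ and satisfies $$\sum_{k=1}^\infty \frac{1}{|f^{(k)}|_I^{1/k}}=\infty .$$
   Context: A compact plane set is a non-empty compact subset of $\mathbb{C}$. A Swiss cheese set is a compact plane set obtained by deleting a sequence of open discs from a closed disc. For a compact plane set $X$, $C(X)$ denotes the algebra of all continuous functions $X\to\mathbb{C}$, and $R(X)$ denotes the set of all $f\in C(X)$ which can be uniformly approximated on $X$ by rational functions with no poles on $X$. For $x\in X$, let $J_x$ be the ideal of all $f\in R(X)$ such that $x$ lies in the interior (relative to $X$) of the zero set $f^{-1}(\{0\})$, and let $M_x=\{f\in R(X): f(x)=0\}$. A point $x\in X$ is a point of continuity for $R(X)$ if for all $y\in X\setminus\{x\}$ we have $J_y\not\subseteq M_x$. A point $x\in X$ is an R-point for $R(X)$ if for all $y\in X\setminus\{x\}$ we have $J_x\not\subseteq M_y$. All line segments are non-degenerate line segments in $\mathbb{C}$. Derivatives of a function $f$ on a line segment $I$ are defined as limits of difference quotients $(f(w)-f(z))/(w-z)$ using points $w,z$ of the segment $I$ only, and $f^{(k)}$ denotes the $k$-th such derivative. For a function $g$ on $I$, $|g|_I=\sup_{z\in I}|g(z)|$. The convention $1/0=\infty$ is used, so the sum is $\infty$ if some $f^{(k)}$ ($k\ge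 1$) vanishes identically on $I$. *)

(* Defs.v *)
From HB Require Import structures.
From mathcomp Require Import all_boot all_order all_algebra.
From mathcomp Require Export complex.
From mathcomp Require Import all_classical all_reals all_analysis.

Set Implicit Arguments.
Unset Strict Implicit.
Unset Printing Implicit Defensive.

Import Order.TTheory GRing.Theory Num.Theory.
Import numFieldNormedType.Exports.
Import ComplexField.Normc.
Local Open Scope classical_set_scope.
Local Open Scope complex_scope.
Local Open Scope ring_scope.

(* Packing R[i] as a numClosedFieldType is what lets the norm and the topology
   that MathComp-Analysis puts on numeric fields be inferred. *)
Definition Cplx (R : realType) : numClosedFieldType := R[i].

Section plane_sets.
Variable R : realType.
Local Notation C := (Cplx R).
Implicit Types X I : set C.

Definition open_disc (c : C) (r : R) : set C := [set z | normc (z - c) < r].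

Definition closed_disc (c : C) (r : R) : set C := [set z | normc (z - c) <= r].

Definition compact_plane_set X := X !=set0 /\ compact X.

(* The deleted discs may overlap one another and need not lie in the closed
   disc, so deleting finitely many discs (or none) is also covered. *)
Definition swiss_cheese_set X :=
  compact_plane_set X /\
  exists (c0 : C) (r0 : R) (c : nat -> C) (r : nat -> R),
    [/\ 0 < r0, forall n, 0 < r n &
        X = closed_disc c0 r0 `\` \bigcup_n open_disc (c n) (r n)].

Definition closed_segment (a b : C) : set C :=
  [set ((1 - t)%:C : C) * a + (t%:C : C) * b | t in `[0, 1]%classic].

(* A function on X is represented by a total function C -> C, of which only the
   values on X matter. *)
Definition CX X : set (C -> C) := [set f | {within X, continuous f}].

Definition RX X : set (C -> C) :=
  [set f | CX X f /\
    forall e : R, 0 < e ->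
      exists p q : {poly C}, (forall z, X z -> q.[z] != 0) /\
        forall z, X z -> normc (f z - p.[z] / q.[z]) < e].

Definition ideal_J X (x : C) : set (C -> C) :=
  [set f | RX X f /\ interior (f @^-1` [set 0] : set (subspace X)) x].

Definition ideal_M X (x : C) : set (C -> C) := [set f | RX X f /\ f x = 0].

Definition point_of_continuity X (x : C) :=
  X x /\ forall y, (X `\ x) y -> ~ (ideal_J X y `<=` ideal_M X x).

Definition R_point X (x : C) :=
  X x /\ forall y, (X `\ x) y -> ~ (ideal_J X x `<=` ideal_M X y).

Definition segment_quotient I (f : C -> C) (z : C) :=
  (f w - f z) / (w - z) @[w --> within I z^'].

Definition segment_deriv I (f : C -> C) : C -> C :=
  fun z => lim (segment_quotient I f z).

Definition segment_derivn I (k : nat) (f : C -> C) : C -> C :=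
  iter k (segment_deriv I) f.

Definition infinitely_differentiable_on I (f : C -> C) :=
  forall (k : nat) (z : C), I z ->
    cvg (segment_quotient I (segment_derivn I k f) z).

Definition sup_norm I (g : C -> C) : \bar R :=
  ereal_sup [set (normc (g z))%:E | z in I].

End plane_sets.

(* Main.v *)
Require Import Defs.
From HB Require Import structures.
From mathcomp Require Import all_boot all_order all_algebra.
From mathcomp Require Import complex.
From mathcomp Require Import all_classical all_reals all_analysis.
From mathcomp Require Import ring lra zify.

Set Implicit Arguments.
Unset Strict Implicit.
Unset Printing Implicit Defensive.

Import Order.TTheory GRing.Theory Num.Theory.
Import numFieldNormedType.Exports.
Import ComplexField.Normc.
Local Open Scope classical_set_scope.
Local Open Scope ring_scope.

(** The set X is the closed unit disc minus countably many open discs, which are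
    grouped on circles centred off K.

    Regularity off K follows an idea of McKissick, in the form given by Koerner.
    The rational function 1 / (1 - w ^ n), with w = (z - c) / rho, is close to 1
    inside the circle |z - c| = rho, close to 0 outside, and, off n discs of
    radius rho * kappa / n centred at its poles, bounded by 2 / kappa whatever n is
    ([circle_factor_approx], [circle_factor_bound]).  For circles which increase
    to |z - c| = s, the product of these functions converges uniformly off the
    discs to a function which vanishes for |z - c| >= s and not near c, provided
    that the exponents n grow fast enough ([product_limit]).  Using the functions
    1 - 1 / (1 - w ^ n) and circles which decrease to |z - c| = s / 2 produces
    a function which vanishes near c and not far away.  With c and s running
    through a countable family which covers the complement of K finely
    ([disc_family]), the first functions make the points of X minus K points of
    continuity and the second ones make them R-points ([X_regular]).  The total
    radius rho * kappa of the discs on a circle can be chosen at will.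

    Smoothness on K comes from Cauchy's formula.  If the discs have radii r_i
    and centres at distance at least d_i from K, then a rational function f without
    poles on X satisfies |f^(k)| <= k! (C ^ (k + 1) + sum r_i (2 / d_i) ^ (k + 1)) |f|_X
    on K.  By compactness finitely many discs matter ([cheese_stage]).  Those
    which meet are merged into larger discs, without changing the sum of the
    radii ([clusters]); as the r_i are small with respect to the d_i, the merged
    discs remain far from K, and their boundaries, together with a circle close to
    the unit circle, form a contour ([cauchy_estimates]).  Integrals along circles
    are replaced by limits of means over roots of unity, for which Cauchy's
    formula is checked on partial fractions ([cauchy_formula]).  The formula also
    bounds the second order Taylor remainders, so that the derivatives pass to
    uniform limits in the sense of Whitney ([RX_smooth]).

    Finally the radii are chosen so small that the sum above is at most H_k ^ k,
    where H_k is the k-th harmonic sum; this is possible because H_k tends to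
    infinity ([geometric_le_harmonic]).  Then |f^(k)| ^ (1 / k) is at most
    a constant times k H_k, and the sum of 1 / (k H_k) diverges ([abel_dini]). *)

(** * The modulus and the topology of the complex plane *)

Section modulus.
Variable R : realType.
Local Notation C := (Cplx R).
Implicit Types (x y z : C).

Lemma modM x y : normc (x * y) = normc x * normc y.
Proof. exact: normcM. Qed.

Lemma modV x : normc (x^-1) = (normc x)^-1.
Proof. exact: normcV. Qed.

Lemma mod_div x y : normc (x / y) = normc x / normc y.
Proof. by rewrite modM modV. Qed.

Lemma modN x : normc (- x) = normc x.
Proof. exact: (@normcN R x). Qed.

Lemma modB x y : normc (x - y) = normc (y - x).
Proof. by rewrite -modN opprB. Qed.

Lemma mod0 : normc (0 : C) = 0. Proof. exact: normc0. Qed.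

Lemma mod1 : normc (1 : C) = 1. Proof. exact: normc1. Qed.

Lemma modX x n : normc (x ^+ n) = normc x ^+ n.
Proof. by elim: n => [|n IH]; rewrite ?expr0 ?mod1// !exprS modM IH. Qed.

Lemma norm_mod z : `|z| = ((normc z)%:C)%C :> C.
Proof. by []. Qed.

Lemma mod_ge0 z : 0 <= normc z.
Proof. by case: z => a b; rewrite sqrtr_ge0. Qed.

Lemma mod_eq0 z : (normc z == 0) = (z == 0).
Proof.
by apply/eqP/eqP => [/eq0_normc//|->]; exact: mod0.
Qed.

Lemma mod_gt0 z : (0 < normc z) = (z != 0).
Proof. by rewrite lt_def mod_ge0 andbT mod_eq0. Qed.

Lemma ler_modD x y : normc (x + y) <= normc x + normc y.
Proof. exact: (@le_normcD R x y). Qed.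

Lemma ler_modB x y : normc (x - y) <= normc x + normc y.
Proof. by rewrite -(modN y) ler_modD. Qed.

Lemma ler_mod_dist y x z : normc (x - z) <= normc (x - y) + normc (y - z).
Proof. by rewrite -[in leLHS](subrK y x) -addrA ler_modD. Qed.

Lemma ler_mod_sub x y : normc x - normc y <= normc (x - y).
Proof. by have := ler_modD (x - y) y; rewrite subrK; lra. Qed.

Lemma ler_mod_sum (I : Type) (r : seq I) (P : pred I) (F : I -> C) :
  normc (\sum_(i <- r | P i) F i) <= \sum_(i <- r | P i) normc (F i).
Proof.
elim/big_ind2: _ => [|x a y b xa yb|//]; first by rewrite mod0.
by rewrite (le_trans (ler_modD _ _))// lerD.
Qed.

Lemma mod_nat n : normc (n%:R : C) = n%:R.
Proof.
have /complexI : ((normc (n%:R : C))%:C = (n%:R : R)%:C)%C.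
  by rewrite -norm_mod normr_nat rmorph_nat.
by [].
Qed.

Lemma mod_real (t : R) : normc ((t%:C)%C : C) = `|t|.
Proof. by rewrite /= expr0n addr0 sqrtr_sqr. Qed.

Lemma mod_real_ge0 (t : R) : 0 <= t -> normc ((t%:C)%C : C) = t.
Proof. by move=> t0; rewrite mod_real ger0_norm. Qed.

Lemma mod_Re_le z : `|complex.Re z| <= normc z.
Proof.
have := normc_ge_Re z; rewrite -[`|z|]/((normc z)%:C)%C.
by rewrite lecR.
Qed.

Lemma mod_ReIm_le (a b : R) : normc ((a +i* b)%C : C) <= `|a| + `|b|.
Proof.
rewrite -(@ler_pXn2r _ 2)// ?nnegrE ?addr_ge0 ?mod_ge0//=.
rewrite sqr_sqrtr ?addr_ge0 ?sqr_ge0// sqrrD !real_normK ?num_real//.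
by rewrite lerD2r lerDl mulrn_wge0// mulr_ge0.
Qed.

(** The balls of the topology have their radii in the field of complex numbers;
    positive elements of this field are real. *)
Lemma nbhs_modP z (A : set C) :
  nbhs z A <-> exists2 e : R, 0 < e & forall w, normc (w - z) < e -> A w.
Proof.
split.
  move=> /nbhs_ballP [[e f] /=]; rewrite ltcE /= => /andP[/eqP f0 e0] sub.
  exists e => // w we; apply: sub; rewrite -ball_normE /=.
  by rewrite -normrN opprB norm_mod f0 ltcE /= eqxx.
move=> [e e0 sub]; apply/nbhs_ballP; exists ((e%:C)%C : C) => /=.
  by rewrite ltcE /= eqxx.
move=> w; rewrite -ball_normE /= => we; apply: sub.
by move: we; rewrite -normrN opprB norm_mod ltcE /= => /andP[].
Qed.

End modulus.

(** * Limits along an ultrafilter *)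

Section ultralimit.
Variable R : realType.
Local Notation C := (Cplx R).
Implicit Types (u v : nat -> C) (z : C).

Lemma mod_hausdorff : hausdorff_space C.
Proof. exact: norm_hausdorff. Qed.

(** The disc is a closed subset of the image of a compact square. *)
Lemma compact_disc (c : C) (r : R) : compact (closed_disc c r).
Proof.
pose f (p : R * R) : C := (p.1 +i* p.2)%C.
pose I : set R := `[- (normc c + r), normc c + r]%classic.
have cf : continuous f.
  move=> [a b] A /nbhs_modP [e e0 sub].
  have e2 : 0 < e / 2 by rewrite divr_gt0.
  exists (ball a (e / 2), ball b (e / 2)); first by split; exact: nbhsx_ballx.
  move=> [x y] [/= ax bY]; apply: sub.
  have -> : f (x, y) - f (a, b) = ((x - a) +i* (y - b))%C by [].
  move: ax bY; rewrite -!ball_normE /= distrC [in `|b - y|]distrC => ax bY.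
  by rewrite (le_lt_trans (mod_ReIm_le _ _))//; lra.
have cI : compact (f @` (I `*` I)).
  apply: continuous_compact; last by apply: compact_setX; exact: segment_compact.
  by apply: continuous_subspaceT.
apply: (subclosed_compact _ cI).
  rewrite closedE => z nz; apply: contrapT => /negP; rewrite -ltNge => rz.
  apply: nz; apply/nbhs_modP; exists (normc (z - c) - r); first by rewrite subr_gt0.
  move=> w wz; apply/negP; rewrite -ltNge.
  have := ler_mod_dist w z c; rewrite [in normc (z - w)]modB; lra.
move=> z; rewrite /closed_disc /mkset => zc.
have zn : normc z <= normc c + r.
  by have := ler_modD (z - c) c; rewrite subrK; lra.
exists (complex.Re z, complex.Im z); last by case: (z).
have Im_le : `|complex.Im z| <= normc z.
  case: (z) => a b /=; rewrite -(@ler_pXn2r _ 2)// ?nnegrE ?sqrtr_ge0//.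
  by rewrite sqr_sqrtr ?addr_ge0 ?sqr_ge0// real_normK ?num_real// lerDr sqr_ge0.
by split; rewrite /I /= in_itv /= -ler_norml;
  [exact: le_trans (mod_Re_le _) zn|exact: le_trans Im_le zn].
Qed.

(** Every bounded sequence converges along this ultrafilter.  Limits of
    approximations are thus chosen at all points and for all orders of
    differentiation at once, without extracting subsequences. *)
Definition free_ultrafilter : set_system nat :=
  sval (cid (@ultraFilterLemma nat \oo _)).

Lemma free_ultrafilter_ultra : UltraFilter free_ultrafilter.
Proof. by rewrite /free_ultrafilter; case: cid => G []. Qed.

Lemma free_ultrafilter_proper : ProperFilter free_ultrafilter.
Proof. by have := free_ultrafilter_ultra; exact: @ultra_proper. Qed.

Lemma free_ultrafilter_oo : \oo `<=` free_ultrafilter.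
Proof. by rewrite /free_ultrafilter; case: cid => G []. Qed.

Definition ulim u : C := get [set z | u @ free_ultrafilter --> z].

Definition bounded_seq u := exists M : R, forall n, normc (u n) <= M.

Lemma ulimP u : bounded_seq u -> u @ free_ultrafilter --> ulim u.
Proof.
move=> [M uM]; apply: (@getPex _ [set z | u @ free_ultrafilter --> z]).
have FU := free_ultrafilter_ultra; have FP := free_ultrafilter_proper.
have UU : UltraFilter (u @ free_ultrafilter).
  split; first exact: fmap_proper_filter.
  move=> G GP uG.
  apply/seteqP; split => // A GA.
  have [//|nA] := in_ultra_setVsetC (u @^-1` A) FU.
  exfalso.
  have : G set0.
    have : G (~` A) by apply: uG.
    by move=> GnA; rewrite -(setICr A); apply: filterI.
  by move=> /filter_not_empty.
have [] : closed_disc (0 : C) M `&` [set p | u @ free_ultrafilter --> p] !=set0.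
  have := @compact_disc 0 M; rewrite compact_ultra; apply => //.
  by apply: (@filterE _ free_ultrafilter) => n /=; rewrite /closed_disc /= subr0.
by move=> z [_ zu]; exists z.
Qed.

Lemma ulim_cvg u z : u @ free_ultrafilter --> z -> ulim u = z.
Proof.
have FP := free_ultrafilter_proper.
move=> uz.
have uu : u @ free_ultrafilter --> ulim u.
  exact: (@getPex _ [set z | u @ free_ultrafilter --> z] (ex_intro _ z uz)).
have FF : ProperFilter (u @ free_ultrafilter) by exact: fmap_proper_filter.
exact: (@cvg_unique C mod_hausdorff (u @ free_ultrafilter) FF _ _ uu uz).
Qed.

Lemma ulim_lim u z :
  (forall e : R, 0 < e -> exists n0, forall n, (n0 <= n)%N -> normc (u n - z) <= e) ->
  ulim u = z.
Proof.
move=> uz; apply: ulim_cvg => A /nbhs_modP [e e0 sub].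
apply: free_ultrafilter_oo.
have [|n0 un] := uz (e / 2); first by rewrite divr_gt0.
exists n0 => // n /= n0n; apply: sub; rewrite (le_lt_trans (un _ n0n))//; lra.
Qed.

Lemma ulim_closed (A : set C) u : closed A -> bounded_seq u ->
  (exists n0, forall n, (n0 <= n)%N -> A (u n)) -> A (ulim u).
Proof.
have FP := free_ultrafilter_proper.
move=> cA bu [n0 un].
have uA : free_ultrafilter [set n | A (u n)].
  by apply: free_ultrafilter_oo; exists n0.
apply: contrapT => nA.
have uN : free_ultrafilter [set n | (~` A) (u n)].
  by apply: (ulimP bu); apply: open_nbhs_nbhs; split => //; rewrite openC.
apply: (@filter_not_empty _ free_ultrafilter).
by rewrite (_ : set0 = [set n | A (u n)] `&` [set n | (~` A) (u n)]);
  [exact: filterI|apply/seteqP; split => n [] //].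
Qed.

Lemma ulimD u v : bounded_seq u -> bounded_seq v ->
  ulim (fun n => u n + v n) = ulim u + ulim v.
Proof.
have FP := free_ultrafilter_proper.
by move=> bu bv; apply: ulim_cvg; apply: cvgD; exact: ulimP.
Qed.

Lemma ulimZ (a : C) u : bounded_seq u -> ulim (fun n => a * u n) = a * ulim u.
Proof.
have FP := free_ultrafilter_proper.
by move=> bu; apply: ulim_cvg; apply: cvgM; [exact: cvg_cst|exact: ulimP].
Qed.

Lemma closed_mod_le (c : C) (r : R) : closed (closed_disc c r).
Proof. by apply: compact_closed; [exact: mod_hausdorff|exact: compact_disc]. Qed.

Lemma ulim_le u (M : R) : bounded_seq u ->
  (exists n0, forall n, (n0 <= n)%N -> normc (u n) <= M) -> normc (ulim u) <= M.
Proof.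
move=> bu [n0 un]; have := @ulim_closed (closed_disc 0 M) u.
rewrite /closed_disc /= subr0; apply => //; first exact: closed_mod_le.
by exists n0 => n /un; rewrite subr0.
Qed.

Lemma bounded_seqD u v : bounded_seq u -> bounded_seq v ->
  bounded_seq (fun n => u n + v n).
Proof.
move=> [M uM] [M' vM]; exists (M + M') => n.
by rewrite (le_trans (ler_modD _ _))// lerD.
Qed.

Lemma bounded_seqZ (a : C) u : bounded_seq u -> bounded_seq (fun n => a * u n).
Proof.
move=> [M uM]; exists (normc a * M) => n.
by rewrite modM ler_wpM2l// mod_ge0.
Qed.

Lemma eq_ulim u v : u =1 v -> ulim u = ulim v.
Proof. by move=> /funext ->. Qed.

End ultralimit.

(** * Roots of unity and infinite products *)

Section roots.
Variable R : realType.
Local Notation C := (Cplx R).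

Lemma ulim_cst (z : C) : ulim (fun=> z) = z.
Proof.
by apply: ulim_lim => e e0; exists 0%N => n _; rewrite subrr mod0 ltW.
Qed.

Lemma ulim_dist (u : nat -> C) (z : C) (M : R) : bounded_seq u ->
  (exists n0, forall n, (n0 <= n)%N -> normc (u n - z) <= M) ->
  normc (ulim u - z) <= M.
Proof.
move=> bu uM; have bz : bounded_seq (fun _ : nat => - z) by exists (normc (- z)).
have -> : ulim u - z = ulim (fun n => u n + - z) by rewrite ulimD// ulim_cst.
by apply: ulim_le => //; exact: bounded_seqD.
Qed.

Lemma mod_unity_root n (z : C) : (0 < n)%N -> z ^+ n = 1 -> normc z = 1.
Proof.
move=> n0 /(congr1 (@normc R)); rewrite modX mod1 => /eqP.
by rewrite pexpr_eq1 ?mod_ge0// => /eqP.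
Qed.

(** Square roots are extracted one after the other.  If the distance from u ^ 2 to
    z is at most 1 / D and y is the square root of z closest to u, then
    |u + y| >= 2 - |u - y| shows that the distance from u to y is at most
    1 / (1 + 2 (D - 1)). *)
Lemma unity_root_near m (u : C) (t : R) : 0 < t -> t <= 2^-1 ->
  normc (u ^+ (2 ^ m) - 1) <= t ->
  exists2 z : C, z ^+ (2 ^ m) = 1 &
    normc (u - z) * (1 + (2 ^ m)%:R * (t^-1 - 1)) <= 1.
Proof.
move=> t0 t2; have t2' : 2 <= t^-1 by rewrite -[2]invrK lef_pV2// posrE.
elim: m u => [|m IH] u ut.
  exists 1; rewrite ?expr1n//; move: ut; rewrite expn0 expr1 => ut.
  have -> : 1 + 1 * (t^-1 - 1) = t^-1 :> R by ring.
  by rewrite ler_pdivrMr// mul1r.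
have [|z z1] := IH (u ^+ 2); first by rewrite -exprM -expnS.
set D := 1 + _ => uzD.
have D1 : 1 <= D.
  by rewrite /D lerDl mulr_ge0//; lra.
have [y yz yle] : exists2 y : C, y ^+ 2 = z & normc (u - y) <= normc (u + y).
  have [uz|/ltW uz] := leP (normc (u - sqrtC z)) (normc (u + sqrtC z)).
    by exists (sqrtC z); rewrite ?sqrtCK.
  by exists (- sqrtC z); rewrite ?sqrrN ?sqrtCK// opprK.
have z2 : y ^+ (2 ^ m.+1) = 1 by rewrite expnS exprM yz.
exists y => //.
have y1 : normc y = 1 by apply: mod_unity_root z2; rewrite expn_gt0.
have -> : 1 + (2 ^ m.+1)%:R * (t^-1 - 1) = 2 * D - 1 :> R.
  by rewrite /D expnS natrM; ring.
have sub : 2 <= normc (u + y) + normc (u - y).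
  have -> : 2 = normc ((u + y) - (u - y)).
    have -> : u + y - (u - y) = 2%:R * y by ring.
    by rewrite modM mod_nat y1 mulr1.
  exact: ler_modB.
have xy : normc (u - y) * normc (u + y) * D <= 1.
  by rewrite -modM; have -> : (u - y) * (u + y) = u ^+ 2 - z by rewrite -yz; ring.
have x0 := mod_ge0 (u - y).
set x := normc (u - y) in x0 sub yle xy *; set w := normc (u + y) in sub yle xy.
have xD : x * D <= 1.
  apply: le_trans xy; rewrite ler_pM2r; last lra.
  by rewrite ler_peMr//; lra.
have xxD : x * (2 - x) * D <= 1.
  apply: le_trans xy; rewrite ler_pM2r; last lra.
  by rewrite ler_wpM2l//; lra.
have : x * (x * D - 1) <= 0 by rewrite mulr_ge0_le0// subr_le0.
by move: xxD; lra.
Qed.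

(** The lower bound is independent of [m], so that the exponents can be chosen
    after the total size of the discs around the roots. *)
Lemma unity_root_far m (u : C) (k : R) : 0 < k -> k <= 1 ->
  (forall z : C, z ^+ (2 ^ m) = 1 -> k / (2 ^ m)%:R <= normc (u - z)) ->
  k / 2 <= normc (u ^+ (2 ^ m) - 1).
Proof.
move=> k0 k1 far; rewrite leNgt; apply/negP => tk.
have n0 : 0 < (2 ^ m)%:R :> R by rewrite ltr0n expn_gt0.
have [u1|u1] := eqVneq (u ^+ (2 ^ m)) 1.
  have := far _ u1; rewrite subrr mod0 leNgt divr_gt0//.
set t := normc (_ - 1) in tk.
have t0 : 0 < t by rewrite mod_gt0 subr_eq0.
have t2 : t <= 2^-1 by lra.
have [z /far zk] := unity_root_near t0 t2 (lexx t).
apply/negP; rewrite -ltNge.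
have kt : 2 < k * t^-1 by rewrite ltr_pdivlMr//; lra.
have s0 : 0 <= t^-1 - 1.
  by rewrite subr_ge0 invf_ge1//; lra.
have kn0 : 0 < k / (2 ^ m)%:R by rewrite divr_gt0.
apply: (@lt_le_trans _ _ (k / (2 ^ m)%:R * (1 + (2 ^ m)%:R * (t^-1 - 1)))).
  rewrite mulrDr mulr1 mulrA divfK ?gt_eqF//.
  by rewrite mulrBr; lra.
by rewrite ler_wpM2r// addr_ge0// mulr_ge0// ltW.
Qed.

Lemma expr_small (q d : R) : 0 <= q -> q < 1 -> 0 < d -> exists n, q ^+ n <= d.
Proof.
move=> q0 q1 d0.
have /cvg_expr cq : `|q| < 1 by rewrite ger0_norm.
have /cvgrPdist_le /(_ _ d0) [n _ /(_ n (leqnn n))] := cq.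
rewrite sub0r normrN ger0_norm ?exprn_ge0// => qn.
by exists n.
Qed.

End roots.

Section products.
Variable R : realType.
Local Notation C := (Cplx R).

(** The precision required from the n-th factor.  It involves the bounds of the
    factors up to the next one, and these do not depend on the exponents: each
    exponent can be chosen large enough to meet its budget. *)
Definition error_budget (B : nat -> R) (n : nat) : R :=
  2^-1 ^+ (n + 3) / \prod_(r < n.+2) (B r + 1).

Section limit.
Variables (B : nat -> R) (h : nat -> C -> C) (X : set C).
Hypothesis B_ge0 : forall n, 0 <= B n.
Hypothesis h_le : forall n z, X z -> normc (h n z) <= B n.
Hypothesis h_small : forall n z, X z ->
  normc (h n.+1 z - 1) <= error_budget B n.+1 \/ normc (h n z) <= error_budget B n.

Let P n z := \prod_(r < n) h r z.
Let b n := \prod_(r < n) (B r + 1).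

Let b_ge1 n : 1 <= b n.
Proof.
rewrite /b; elim: n => [|n IH]; first by rewrite big_ord0.
by rewrite big_ord_recr /= mulr_ege1// lerDr.
Qed.

Let b_mono n : b n <= b n.+1.
Proof.
by rewrite {2}/b big_ord_recr /= ler_peMr ?lerDr// (le_trans ler01)// b_ge1.
Qed.

Let e_ge0 n : 0 <= error_budget B n.
Proof.
rewrite /error_budget divr_ge0 ?exprn_ge0//.
exact: (le_trans ler01 (b_ge1 n.+2)).
Qed.

Let b_budget n : b n.+2 * error_budget B n = 2^-1 ^+ (n + 3).
Proof.
rewrite /error_budget -/(b n.+2) mulrC divfK// gt_eqF//.
exact: lt_le_trans ltr01 (b_ge1 _).
Qed.

Let P_le n z : X z -> normc (P n z) <= b n.
Proof.
move=> Xz; rewrite /P /b; elim: n => [|n IH]; first by rewrite !big_ord0 mod1.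
rewrite !big_ord_recr /= modM ler_pM ?mod_ge0//.
by rewrite (le_trans (h_le _ Xz))// lerDl.
Qed.

Let P_small n z : X z -> normc (h n z) <= error_budget B n ->
  normc (P n.+1 z) <= b n * error_budget B n.
Proof.
by move=> Xz hz; rewrite /P big_ord_recr /= modM ler_pM ?mod_ge0// P_le.
Qed.

Let P_step0 n z : X z -> normc (h n z - 1) <= error_budget B n ->
  normc (P n.+1 z - P n z) <= 2^-1 ^+ (n + 3).
Proof.
move=> Xz hz; rewrite /P big_ord_recr /= -[X in _ - X]mulr1 -mulrBr modM.
rewrite -b_budget ler_pM ?mod_ge0// (le_trans (P_le _ Xz))//.
by rewrite (le_trans (b_mono _))// b_mono.
Qed.

Let P_step n z : X z -> normc (P n.+2 z - P n.+1 z) <= 2^-1 ^+ (n + 3).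
Proof.
move=> Xz; have [hz|hz] := h_small n Xz.
  apply: le_trans (P_step0 Xz hz) _.
  by rewrite addSn exprS ler_piMl ?exprn_ge0//; lra.
rewrite /P big_ord_recr /= -/(P n.+1 z) -[X in _ - X]mulr1 -mulrBr modM.
rewrite -b_budget {1}/b big_ord_recr /= -/(b n.+1) mulrAC ler_pM ?mod_ge0//.
  apply: le_trans (P_small Xz hz) _.
  by rewrite ler_wpM2r.
by rewrite (le_trans (ler_modB _ _))// mod1 lerD2r h_le.
Qed.

Let P_cauchy n j z : X z ->
  normc (P (n.+1 + j) z - P n.+1 z) <= 2^-1 ^+ (n + 2) - 2^-1 ^+ (n + j + 2).
Proof.
move=> Xz; elim: j => [|j IH]; first by rewrite !addn0 !subrr mod0.
apply: le_trans (ler_mod_dist (P (n.+1 + j) z) _ _) _.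
rewrite addnS addSn; have := P_step (n + j) Xz.
rewrite addSn in IH *.
have -> : (n + j.+1 + 2 = (n + j + 2).+1)%N by lia.
have -> : (n + j + 3 = (n + j + 2).+1)%N by lia.
rewrite exprS; lra.
Qed.

Let P_bounded z : X z -> bounded_seq (fun n => P n z).
Proof.
move=> Xz; exists (b 1 + 1 + 2^-1 ^+ 2) => -[|n].
  rewrite /P big_ord0 mod1.
  by have := b_ge1 1; have : 0 <= 2^-1 ^+ 2 :> R by []; lra.
have := P_cauchy 0 n Xz; have := P_le 1 Xz.
have : 0 <= 2^-1 ^+ (0 + n + 2) :> R by rewrite exprn_ge0.
have := ler_mod_sub (P n.+1 z) (P 1%N z).
by rewrite add0n add1n; lra.
Qed.

(** Multiplying by one more factor hardly changes a partial product: either this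
    factor is close to 1, or the preceding one has already made the product so
    small that the bound for this factor cannot make it large. *)
Lemma product_limit : exists F : C -> C,
  [/\ forall n z, X z -> normc (F z - P n.+1 z) <= 2^-1 ^+ (n + 2),
      forall z, X z -> (forall n, normc (h n z) <= error_budget B n) -> F z = 0 &
      forall z, X z -> (forall n, normc (h n z - 1) <= error_budget B n) ->
        F z != 0].
Proof.
have lim n z : X z -> normc (ulim (fun n => P n z) - P n.+1 z) <= 2^-1 ^+ (n + 2).
  move=> Xz; apply: ulim_dist; first exact: P_bounded.
  exists n.+1 => k nk; rewrite -(subnKC nk).
  rewrite (le_trans (P_cauchy _ _ Xz))//.
  by rewrite gerBl exprn_ge0.
exists (fun z => ulim (fun n => P n z)); split => //.
  move=> z Xz hz; apply/eqP; rewrite -mod_eq0 eq_le mod_ge0 andbT.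
  apply/ler_addgt0Pl => e e0; rewrite addr0.
  have [n ne] : exists n, 2^-1 ^+ n <= e by apply: expr_small => //; lra.
  have := lim n z Xz; have := P_small Xz (hz n).
  have bn : b n * error_budget B n <= 2^-1 ^+ (n + 3).
    rewrite -b_budget ler_wpM2r//.
    by rewrite (le_trans (b_mono _))// b_mono.
  have := ler_mod_sub (ulim (fun n => P n z)) (P n.+1 z).
  move: bn ne; rewrite !exprD !exprS expr0.
  have : 0 <= 2^-1 ^+ n :> R by rewrite exprn_ge0.
  lra.
move=> z Xz hz; rewrite -mod_eq0.
have := lim 0%N z Xz; have := P_step0 Xz (hz 0%N).
rewrite {2}/P big_ord0 => h1 h2.
have := ler_mod_sub 1 (ulim (fun n => P n z)).
have := ler_mod_dist (P 1%N z) (ulim (fun n => P n z)) 1.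
rewrite mod1 [in normc (1 - _)]modB.
by move: h1 h2; rewrite !exprS expr0 => h1 h2 h3 h4; apply/eqP; lra.
Qed.

End limit.
End products.

Section factor.
Variable R : realType.
Local Notation C := (Cplx R).

Definition circle_factor (c : C) (rho : R) (n : nat) (z : C) : C :=
  (1 - ((z - c) / (rho%:C)%C) ^+ n)^-1.

Lemma circle_factor_compl c rho n z :
  1 - ((z - c) / (rho%:C)%C) ^+ n != 0 ->
  circle_factor c rho n z - 1 =
  ((z - c) / (rho%:C)%C) ^+ n * circle_factor c rho n z.
Proof.
by move=> u1; rewrite /circle_factor; field.
Qed.

Lemma expn2_gt m : (m < 2 ^ m)%N.
Proof. exact: ltn_expl. Qed.

Lemma mod_scaled (c z : C) (rho : R) : 0 < rho ->
  normc ((z - c) / (rho%:C)%C) = normc (z - c) / rho.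
Proof. by move=> r0; rewrite mod_div mod_real_ge0// ltW. Qed.

(** Powers of numbers less than 1 in modulus tend to 0: off an annulus around the
    circle, the factor tends to the indicator function of the disc. *)
Lemma circle_factor_approx (lo rho hi e : R) :
  0 < lo -> lo < rho -> rho < hi -> 0 < e ->
  exists m, forall c z : C,
    (normc (z - c) <= lo -> normc (circle_factor c rho (2 ^ m) z - 1) <= e) /\
    (hi <= normc (z - c) -> normc (circle_factor c rho (2 ^ m) z) <= e).
Proof.
move=> lo0 lr rh e0; have r0 : 0 < rho by lra.
have h0 : 0 < hi by lra.
have de0 : 0 < e / (1 + e) by rewrite divr_gt0//; lra.
have [i qi] : exists n, (lo / rho) ^+ n <= e / (1 + e).
  apply: expr_small => //; first by rewrite divr_ge0 // ltW.
  by rewrite ltr_pdivrMr// mul1r.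
have [j qj] : exists n, (rho / hi) ^+ n <= e / (1 + e).
  apply: expr_small => //; first by rewrite divr_ge0 // ltW.
  by rewrite ltr_pdivrMr// mul1r.
exists (i + j)%N => c z; set n := (2 ^ _)%N.
have ni : (i <= n)%N.
  by rewrite ltnW// (leq_ltn_trans (leq_addr j i))// expn2_gt.
have nj : (j <= n)%N.
  by rewrite ltnW// (leq_ltn_trans (leq_addl i j))// expn2_gt.
have lr1 : 0 <= lo / rho <= 1.
  by rewrite divr_ge0 ?(ltW lo0) ?(ltW r0)//= ler_pdivrMr// mul1r ltW.
have rh1 : 0 <= rho / hi <= 1.
  by rewrite divr_ge0 ?(ltW h0) ?(ltW r0)//= ler_pdivrMr// mul1r ltW.
have {ni}qi : (lo / rho) ^+ n <= e / (1 + e).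
  apply: le_trans qi; have /andP[? ?] := lr1; exact: ler_wiXn2l.
have {nj}qj : (rho / hi) ^+ n <= e / (1 + e).
  apply: le_trans qj; have /andP[? ?] := rh1; exact: ler_wiXn2l.
have e1 : e / (1 + e) < 1 by rewrite ltr_pdivrMr//; lra.
set u := (z - c) / (rho%:C)%C; split => zc.
  have un : normc (u ^+ n) <= e / (1 + e).
    apply: le_trans qi; rewrite modX /u mod_scaled//.
    rewrite lerXn2r ?nnegrE ?divr_ge0 ?mod_ge0 ?(ltW lo0) ?(ltW r0)//.
    by rewrite ler_pM2r// invr_gt0.
  have u1 : 1 - e / (1 + e) <= normc (1 - u ^+ n).
    by have := ler_mod_sub 1 (u ^+ n); rewrite mod1; lra.
  have u0 : 0 < normc (1 - u ^+ n) by lra.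
  rewrite circle_factor_compl; last by rewrite -mod_gt0.
  rewrite -/u /circle_factor -/u modM modV ler_pdivrMr//.
  apply: le_trans un _; apply: (@le_trans _ _ (e * (1 - e / (1 + e)))).
    by rewrite le_eqVlt; apply/orP; left; apply/eqP; field; lra.
  by rewrite ler_pM2l.
have un : (1 + e) / e <= normc (u ^+ n).
  have t0 : 0 < normc (z - c) by lra.
  rewrite modX /u mod_scaled//.
  rewrite -[leLHS]invrK -[leRHS]invrK lef_pV2 ?posrE ?invr_gt0 ?exprn_gt0 ?divr_gt0 ?addr_gt0//.
  rewrite invf_div; apply: le_trans qj.
  rewrite -exprVn invf_div.
  rewrite lerXn2r ?nnegrE ?divr_ge0 ?mod_ge0 ?(ltW h0) ?(ltW r0)//.
  by rewrite ler_pM2l// lef_pV2.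
have u1 : e^-1 <= normc (1 - u ^+ n).
  rewrite modB; have := ler_mod_sub (u ^+ n) 1; rewrite mod1.
  have -> : e^-1 = (1 + e) / e - 1 by field; lra.
  lra.
rewrite /circle_factor -/u modV -[leRHS]invrK lef_pV2 ?posrE ?invr_gt0//.
by apply: lt_le_trans u1; rewrite invr_gt0.
Qed.

Lemma circle_factor_bound c rho m k z : 0 < rho -> 0 < k -> k <= 1 ->
  (forall y : C, y ^+ (2 ^ m) = 1 ->
     rho * k / (2 ^ m)%:R <= normc (z - (c + (rho%:C)%C * y))) ->
  1 - ((z - c) / (rho%:C)%C) ^+ (2 ^ m) != 0 /\
  normc (circle_factor c rho (2 ^ m) z) <= 2 / k.
Proof.
move=> r0 k0 k1 far; rewrite /circle_factor.
have rC0 : (rho%:C)%C != 0 :> C by rewrite -mod_gt0 mod_real_ge0 ?ltW.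
set u := (z - c) / _.
have : k / 2 <= normc (u ^+ (2 ^ m) - 1).
  apply: unity_root_far => // y /far.
  have -> : z - (c + (rho%:C)%C * y) = (rho%:C)%C * (u - y).
    by rewrite /u; field.
  by rewrite modM mod_real_ge0 ?(ltW r0)// -mulrA ler_pM2l.
rewrite modB => uk; split; first by rewrite -mod_gt0 (lt_le_trans _ uk)// divr_gt0.
rewrite modV -[leRHS]invrK lef_pV2 ?posrE ?invr_gt0 ?divr_gt0//.
  by rewrite invf_div.
by rewrite (lt_le_trans _ uk)// divr_gt0.
Qed.

End factor.

(** * Means over roots of unity *)

Section means.
Variable R : realType.
Local Notation C := (Cplx R).
Implicit Types (h : C -> C) (p : {poly C}).

(** The mean of [h] over the roots of unity of order 2 ^ m, which are the square
    roots of those of order 2 ^ (m - 1). *)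
Fixpoint unity_mean m h : C :=
  if m is m'.+1 then
    unity_mean m' (fun w => (h (sqrtC w) + h (- sqrtC w)) / 2%:R)
  else h 1.

Lemma mod_sqrtC (w : C) : normc w = 1 -> normc (sqrtC w) = 1.
Proof.
move=> w1; have : normc (sqrtC w) ^+ 2 = 1 by rewrite -modX sqrtCK.
by move=> /eqP; rewrite sqrp_eq1 ?mod_ge0// => /eqP.
Qed.

Lemma eq_unity_mean m h1 h2 : (forall t, normc t = 1 -> h1 t = h2 t) ->
  unity_mean m h1 = unity_mean m h2.
Proof.
elim: m h1 h2 => [|m IH] h1 h2 h12 /=; first by rewrite h12// mod1.
by apply: IH => t t1; rewrite !h12// ?modN mod_sqrtC.
Qed.

Lemma unity_meanD m h1 h2 :
  unity_mean m (fun t => h1 t + h2 t) = unity_mean m h1 + unity_mean m h2.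
Proof.
elim: m h1 h2 => [//|m IH] h1 h2 /=; rewrite -IH.
by apply: eq_unity_mean => t _; rewrite -mulrDl addrACA.
Qed.

Lemma unity_meanZ m (a : C) h :
  unity_mean m (fun t => a * h t) = a * unity_mean m h.
Proof.
elim: m h => [//|m IH] h /=; rewrite -IH.
by apply: eq_unity_mean => t _; rewrite mulrA mulrDr.
Qed.

Lemma unity_mean_sum m (I : Type) (r : seq I) (F : I -> C -> C) :
  unity_mean m (fun t => \sum_(i <- r) F i t) = \sum_(i <- r) unity_mean m (F i).
Proof.
elim: r => [|i r IH].
  rewrite big_nil -[RHS](mul0r (unity_mean m (fun=> 0))) -unity_meanZ.
  by apply: eq_unity_mean => t _; rewrite big_nil mul0r.
rewrite big_cons -IH -unity_meanD.
by apply: eq_unity_mean => t _; rewrite big_cons.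
Qed.

Lemma unity_mean_le m h (M : R) : (forall t, normc t = 1 -> normc (h t) <= M) ->
  normc (unity_mean m h) <= M.
Proof.
elim: m h => [|m IH] h hM /=; first by rewrite hM// mod1.
apply: IH => t t1; rewrite mod_div mod_nat ler_pdivrMr//.
rewrite (le_trans (ler_modD _ _))// mulr_natr mulr2n lerD ?hM ?modN ?mod_sqrtC//.
Qed.

(** Odd powers cancel at opposite roots, and even powers reduce to the preceding
    order.  The function [s] is meant to be the identity or the inversion. *)
Lemma unity_mean_expr (s : C -> C) m k :
  s 1 = 1 -> (forall t, s (- t) = - s t) -> (forall t, s t ^+ 2 = s (t ^+ 2)) ->
  (k < 2 ^ m)%N -> unity_mean m (fun t => s t ^+ k) = (k == 0%N)%:R.
Proof.
move=> s1 sN s2; elim: m k => [|m IH] k km.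
  by move: km; rewrite expn0 ltnS leqn0 => /eqP ->; rewrite /= expr0.
have mean1 j : (j < 2 ^ m)%N ->
  unity_mean m (fun t => (s t ^+ j + s t ^+ j) / 2%:R) = (j == 0%N)%:R.
  move=> jm; rewrite -(IH j jm); apply: eq_unity_mean => t _.
  by field.
have half := odd_double_half k.
have dm : (k./2 < 2 ^ m)%N by move: km; rewrite expnS; lia.
rewrite /=; case: (boolP (odd k)) half => [ok|ek]; rewrite ?add0n => half.
  rewrite (_ : k == 0%N = false) /=; last by lia.
  rewrite (@eq_unity_mean _ _ (fun t => 0 * 1)); last first.
    by move=> t _; rewrite sN exprNn -signr_odd ok expr1 mulN1r subrr !mul0r.
  by rewrite unity_meanZ mul0r.
rewrite -half -muln2 muln_eq0 orbF -(mean1 _ dm).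
apply: eq_unity_mean => t _; rewrite sN mulnC !exprM sqrrN s2.
by rewrite sqrtCK.
Qed.

Lemma unity_mean_poly (s : C -> C) m (r : C) p :
  s 1 = 1 -> (forall t, s (- t) = - s t) -> (forall t, s t ^+ 2 = s (t ^+ 2)) ->
  (size p <= 2 ^ m)%N -> unity_mean m (fun t => p.[r * s t]) = p.[0].
Proof.
move=> s1 sN s2 pm.
rewrite (@eq_unity_mean _ _
    (fun t => \sum_(i < 2 ^ m) (p`_i * r ^+ i) * s t ^+ i)); last first.
  move=> t _; rewrite (horner_coef_wide _ pm); apply: eq_bigr => i _.
  by rewrite exprMn mulrA.
rewrite unity_mean_sum; have : (0 < 2 ^ m)%N by rewrite expn_gt0.
case: (2 ^ m)%N (@unity_mean_expr s m) => // n ms _.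
rewrite big_ord_recl big1 => [|i _]; last first.
  by rewrite unity_meanZ ms// mulr0.
by rewrite unity_meanZ ms// addr0 expr0 !mulr1 horner_coef0.
Qed.

Definition tends (u : nat -> C) (l : C) := forall e : R, 0 < e ->
  exists n0, forall n, (n0 <= n)%N -> normc (u n - l) <= e.

(** This property stands for holomorphy in the disc of centre 0 and radius [r]. *)
Definition poly_approx (r : R) h := forall e : R, 0 < e ->
  exists p, forall t, normc t <= r -> normc (h t - p.[t]) <= e.

Lemma poly_approx_poly r p : poly_approx r (fun t => p.[t]).
Proof. by move=> e e0; exists p => t _; rewrite subrr mod0 ltW. Qed.

Lemma eq_poly_approx r h1 h2 : (forall t, normc t <= r -> h1 t = h2 t) ->
  poly_approx r h1 -> poly_approx r h2.
Proof.
by move=> h12 h1a e /h1a [p ph]; exists p => t tr; rewrite -h12// ph.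
Qed.

Lemma mod_poly_le p (r : R) : exists2 M : R, 0 < M &
  forall t, normc t <= r -> normc p.[t] <= M.
Proof.
elim/poly_ind: p => [|p c [M M0 pM]].
  by exists 1 => // t _; rewrite horner0 mod0.
exists (M * `|r| + normc c + 1).
  by rewrite ltr_wpDl// addr_ge0 ?mod_ge0// mulr_ge0// ltW.
move=> t tr; rewrite hornerMXaddC.
have := ler_modD (p.[t] * t) c; rewrite modM.
have : normc p.[t] * normc t <= M * `|r|.
  by rewrite ler_pM ?mod_ge0 ?pM// (le_trans tr)// ler_norm.
lra.
Qed.

Lemma poly_approxM r h1 h2 : poly_approx r h1 -> poly_approx r h2 ->
  poly_approx r (fun t => h1 t * h2 t).
Proof.
move=> a1 a2 e e0; have e2 : 0 < e / 2 by rewrite divr_gt0.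
have [p0 p0h] := a1 1 ltr01.
have [M0 M00 p0M] := mod_poly_le p0 r.
have M0' : 0 < M0 + 1 by lra.
have [p2 p2h] := a2 (e / 2 / (M0 + 1)) (divr_gt0 e2 M0').
have [M M0_ p2M] := mod_poly_le p2 r.
have [p1 p1h] := a1 (e / 2 / M) (divr_gt0 e2 M0_).
exists (p1 * p2) => t tr; rewrite hornerM.
have -> : h1 t * h2 t - p1.[t] * p2.[t] =
  h1 t * (h2 t - p2.[t]) + (h1 t - p1.[t]) * p2.[t] by ring.
rewrite (le_trans (ler_modD _ _))// !modM (splitr e) lerD//.
  have h1M : normc (h1 t) <= M0 + 1.
    by have := ler_mod_sub (h1 t) p0.[t]; have := p0h t tr; have := p0M t tr; lra.
  have -> : e / 2 = (M0 + 1) * (e / 2 / (M0 + 1)) by field; lra.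
  by rewrite ler_pM ?mod_ge0// p2h.
have -> : e / 2 = (e / 2 / M) * M by field; lra.
by rewrite ler_pM ?mod_ge0// ?p1h// p2M.
Qed.

Lemma poly_approxX r h k : poly_approx r h -> poly_approx r (fun t => h t ^+ k).
Proof.
move=> ha; elim: k => [|k IH].
  apply: eq_poly_approx (@poly_approx_poly r 1) => t _.
  by rewrite expr0 hornerC.
by apply: eq_poly_approx (poly_approxM ha IH) => t _; rewrite exprS.
Qed.

(** The partial sums of the geometric series converge uniformly. *)
Lemma poly_approx_geo (r : R) (b : C) : 0 <= r -> normc b * r < 1 ->
  poly_approx r (fun t => (1 - b * t)^-1).
Proof.
move=> r0 br e e0; set q := normc b * r in br.
have q0 : 0 <= q by rewrite mulr_ge0// mod_ge0.
have [n qn] : exists n, q ^+ n <= e * (1 - q).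
  by apply: expr_small => //; rewrite mulr_gt0//; lra.
exists (\poly_(i < n) b ^+ i) => t tr; rewrite horner_poly.
have btq : normc (b * t) <= q by rewrite modM ler_wpM2l// mod_ge0.
have u1 : 1 - q <= normc (1 - b * t).
  by have := ler_mod_sub 1 (b * t); rewrite mod1; lra.
have u0 : 1 - b * t != 0 by rewrite -mod_gt0; lra.
have -> : (1 - b * t)^-1 - \sum_(i < n) b ^+ i * t ^+ i =
          (b * t) ^+ n / (1 - b * t).
  apply: (mulIf u0); rewrite mulrBl mulVf// divfK//.
  under eq_bigr do rewrite -exprMn.
  by have := subrX1 (b * t) n; rewrite mulrC => /(congr1 (fun x => 1 + x));
     rewrite addrC subrK => ->; ring.
rewrite mod_div ler_pdivrMr; last lra.
apply: (@le_trans _ _ (q ^+ n)).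
  by rewrite modX lerXn2r ?nnegrE ?mod_ge0.
by rewrite (le_trans qn)// ler_pM2l.
Qed.

(** The mean value property: it holds exactly for a polynomial of degree less than
    2 ^ m, since the means of the other powers vanish. *)
Lemma poly_approx_mean (s : C -> C) (r : R) h : 0 <= r ->
  s 1 = 1 -> (forall t, s (- t) = - s t) -> (forall t, s t ^+ 2 = s (t ^+ 2)) ->
  (forall t, normc t = 1 -> normc (s t) = 1) ->
  poly_approx r h ->
  tends (fun m => unity_mean m (fun t => h ((r%:C)%C * s t))) (h 0).
Proof.
move=> r0 s1 sN s2 sm ha e e0.
have e2 : 0 < e / 2 by rewrite divr_gt0.
have [p ph] := ha (e / 2) e2.
exists (size p) => m pm.
have pm' : (size p <= 2 ^ m)%N by rewrite (leq_trans pm)// ltnW// ltn_expl.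
have -> : unity_mean m (fun t => h ((r%:C)%C * s t)) - h 0 =
  unity_mean m (fun t => h ((r%:C)%C * s t) + (-1) * p.[(r%:C)%C * s t])
  - (h 0 - p.[0]).
  by rewrite unity_meanD unity_meanZ unity_mean_poly//; ring.
rewrite (le_trans (ler_modB _ _))// (splitr e) lerD ?ph ?mod0//.
apply: unity_mean_le => t t1; rewrite mulN1r ph// modM mod_real_ge0// sm//.
by rewrite mulr1.
Qed.

End means.

Section tends_theory.
Variable R : realType.
Local Notation C := (Cplx R).
Implicit Types (u v : nat -> C).

Lemma eq_tends u v l : u =1 v -> tends u l -> tends v l.
Proof. by move=> /funext ->. Qed.

Lemma ulim_tends u l : tends u l -> ulim u = l.
Proof. exact: ulim_lim. Qed.

Lemma tends_cst l : tends (fun=> l : C) l.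
Proof. by move=> e e0; exists 0%N => n _; rewrite subrr mod0 ltW. Qed.

Lemma tendsD u v l l' : tends u l -> tends v l' ->
  tends (fun n => u n + v n) (l + l').
Proof.
move=> ul vl e e0; have e2 : 0 < e / 2 by rewrite divr_gt0.
have [n0 n0u] := ul _ e2; have [n1 n1v] := vl _ e2.
exists (maxn n0 n1) => n; rewrite geq_max => /andP[/n0u un /n1v vn].
rewrite (_ : _ - _ = (u n - l) + (v n - l')); last by ring.
by rewrite (le_trans (ler_modD _ _))// (splitr e) lerD.
Qed.

Lemma tendsN u l : tends u l -> tends (fun n => - u n) (- l).
Proof.
move=> ul e /ul [n0 n0u]; exists n0 => n /n0u.
by rewrite -opprD modN.
Qed.

End tends_theory.

(** * Means along circles *)

Section circle_means.
Variable R : realType.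
Local Notation C := (Cplx R).
Implicit Types (c a : C) (r : R) (h : C -> C).

(** A Riemann sum for the integral of [h] along the circle, divided by 2 i pi: if
    w = c + r t with t = exp (i x), then dw = i r t dx. *)
Definition circle_mean m c r h : C :=
  unity_mean m (fun t => (r%:C)%C * t * h (c + (r%:C)%C * t)).

Lemma circle_mean_le m c r h M : 0 <= r ->
  (forall w, normc (w - c) = r -> normc (h w) <= M) ->
  normc (circle_mean m c r h) <= r * M.
Proof.
move=> r0 hM; apply: unity_mean_le => t t1.
rewrite !modM mod_real_ge0// t1 mulr1 ler_wpM2l// hM//.
by rewrite addrAC subrr add0r modM mod_real_ge0// t1 mulr1.
Qed.

Lemma eq_circle_mean m c r h1 h2 : 0 <= r ->
  (forall w, normc (w - c) = r -> h1 w = h2 w) ->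
  circle_mean m c r h1 = circle_mean m c r h2.
Proof.
move=> r0 h12; apply: eq_unity_mean => t t1; rewrite h12//.
by rewrite addrAC subrr add0r modM mod_real_ge0// t1 mulr1.
Qed.

Lemma circle_meanD m c r h1 h2 :
  circle_mean m c r (fun w => h1 w + h2 w) =
  circle_mean m c r h1 + circle_mean m c r h2.
Proof.
by rewrite -unity_meanD; apply: eq_unity_mean => t _; rewrite mulrDr.
Qed.

Lemma circle_meanZ m c r a h :
  circle_mean m c r (fun w => a * h w) = a * circle_mean m c r h.
Proof.
by rewrite -unity_meanZ; apply: eq_unity_mean => t _; rewrite mulrCA.
Qed.

Lemma circle_mean_analytic c r h : 0 <= r ->
  poly_approx r (fun s => h (c + s)) ->
  tends (fun m => circle_mean m c r h) 0.
Proof.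
move=> r0 ha.
have ha' : poly_approx r (fun s => s * h (c + s)).
  apply: poly_approxM ha.
  by apply: eq_poly_approx (@poly_approx_poly R r 'X) => t _; rewrite hornerX.
have := @poly_approx_mean R id r _ r0 erefl (fun=> erefl) (fun=> erefl)
  (fun _ => id) ha'.
by rewrite mul0r.
Qed.

Lemma circle_mean_poly c r (p : {poly C}) : 0 <= r ->
  tends (fun m => circle_mean m c r (fun w => p.[w])) 0.
Proof.
move=> r0; apply: circle_mean_analytic => //.
apply: eq_poly_approx (@poly_approx_poly R r (p \Po ('X + c%:P))) => t _.
by rewrite horner_comp hornerD hornerX hornerC addrC.
Qed.

Lemma circle_mean_pole_out c r a k : 0 <= r -> r < normc (a - c) ->
  tends (fun m => circle_mean m c r (fun w => (w - a)^-1 ^+ k.+1)) 0.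
Proof.
move=> r0 ra; apply: circle_mean_analytic => //; apply: poly_approxX.
have a0 : a - c != 0 by rewrite -mod_gt0; lra.
have geo : poly_approx r (fun t => (1 - (a - c)^-1 * t)^-1).
  apply: poly_approx_geo => //.
  by rewrite modV mulrC ltr_pdivrMr ?mul1r//; lra.
have cst := @poly_approx_poly R r (- (a - c)^-1)%:P.
apply: eq_poly_approx (poly_approxM cst geo) => t tr.
have t0 : c + t - a != 0.
  rewrite -mod_gt0 -modN; have := ler_mod_sub (a - c) t.
  by rewrite (_ : - (c + t - a) = a - c - t); [lra|ring].
rewrite hornerC; field.
by rewrite t0 a0 /= (_ : a - c - t = - (c + t - a)) ?oppr_eq0//; ring.
Qed.

(** In terms of s = 1 / (w - c), which runs through the circle of radius 1 / r, the
    quantity averaged is s ^ k / (1 - (a - c) s) ^ (k + 1); this is holomorphic in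
    the disc bounded by that circle. *)
Lemma circle_mean_pole_in c r a k : normc (a - c) < r ->
  tends (fun m => circle_mean m c r (fun w => (w - a)^-1 ^+ k.+1))
        (k == 0%N)%:R.
Proof.
move=> ar; have r0 : 0 < r by exact: le_lt_trans (mod_ge0 _) ar.
have rC0 : (r%:C)%C != 0 :> C by rewrite -mod_gt0 mod_real_ge0 ?ltW.
have ri0 : 0 <= r^-1 by rewrite invr_ge0 ltW.
pose H (s : C) := s ^+ k * (1 - (a - c) * s)^-1 ^+ k.+1.
have Ha : poly_approx r^-1 H.
  apply: poly_approxM.
    apply: eq_poly_approx (@poly_approx_poly R r^-1 'X^k) => t _.
    by rewrite hornerXn.
  apply: poly_approxX; apply: poly_approx_geo => //.
  by rewrite ltr_pdivrMr// mul1r.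
have H0 : H 0 = (k == 0%N)%:R.
  rewrite /H mulr0 subr0 invr1 expr1n mulr1 expr0n.
  by [].
rewrite -H0.
have inv1 (t : C) : normc t = 1 -> normc t^-1 = 1.
  by move=> t1; rewrite modV t1 invr1.
have T := @poly_approx_mean R GRing.inv r^-1 H ri0 (invr1 _) (@invrN _)
  (fun t => exprVn t 2) inv1 Ha.
apply: eq_tends T.
move=> m; apply: eq_unity_mean => t t1.
have t0 : t != 0 by rewrite -mod_gt0 t1.
have n0 : (r%:C)%C * t - (a - c) != 0.
  rewrite -mod_gt0; have := ler_mod_sub ((r%:C)%C * t) (a - c).
  by rewrite modM mod_real_ge0 ?(ltW r0)// t1 mulr1; lra.
have n1 : c + (r%:C)%C * t - a != 0.
  by rewrite (_ : _ - a = (r%:C)%C * t - (a - c)) //; ring.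
have -> : ((r^-1)%:C)%C = ((r%:C)%C : C)^-1 by rewrite fmorphV.
rewrite /H.
have -> : (1 - (a - c) * ((r%:C)%C^-1 * t^-1))^-1 =
  (r%:C)%C * t * (c + (r%:C)%C * t - a)^-1 :> C.
  by field; rewrite n1 rC0 t0.
have gen (x y : C) : x != 0 -> x^-1 ^+ k * (x * y) ^+ k.+1 = x * y ^+ k.+1.
  move=> x0; have xk0 : x ^+ k != 0 by rewrite expf_neq0.
  rewrite exprMn exprVn [x ^+ k.+1]exprS; move: (y ^+ _) (x ^+ k) xk0 => u v v0.
  by field.
by rewrite -invfM gen// mulf_neq0.
Qed.

End circle_means.

(** * Partial fractions *)

Section partial_fractions.
Variable R : realType.
Local Notation C := (Cplx R).
Implicit Types (f g : C -> C) (S : set C).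

(** Partial fractions with poles in [S], up to the values on [S].  The inductive
    form lets linear formulas be checked on the generators. *)
Inductive rational_span S : (C -> C) -> Prop :=
| RSpoly (p : {poly C}) : rational_span S (fun w => p.[w])
| RSpole a k : S a -> rational_span S (fun w => (w - a)^-1 ^+ k.+1)
| RSadd f g : rational_span S f -> rational_span S g ->
    rational_span S (fun w => f w + g w)
| RSscale b f : rational_span S f -> rational_span S (fun w => b * f w)
| RSext f g : (forall w, ~ S w -> f w = g w) ->
    rational_span S f -> rational_span S g.

(** Two distinct poles are separated by
    1 / ((w - b) (w - a)) = (1 / (w - b) - 1 / (w - a)) / (b - a). *)
Lemma rational_span_pole S a b k : S a -> S b ->
  rational_span S (fun w => (w - b)^-1 ^+ k.+1 / (w - a)).
Proof.
move=> Sa Sb; have [->|ba] := eqVneq b a.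
  apply: RSext (RSpole k.+1 Sa) => w _.
  by rewrite exprSr.
have ba0 : b - a != 0 by rewrite subr_eq0.
have off w x : ~ S w -> S x -> w != x by move=> Sw Sx; apply/eqP => wx; rewrite wx in Sw.
elim: k => [|k IH].
  apply: (@RSext _ (fun w => (b - a)^-1 * ((w - b)^-1 ^+ 1 + (-1) * (w - a)^-1 ^+ 1))).
    move=> w Sw; rewrite !expr1; field.
    by rewrite ba0 !subr_eq0 !(off w).
  by apply: RSscale; apply: RSadd; [exact: RSpole|apply: RSscale; exact: RSpole].
apply: (@RSext _ (fun w => (b - a)^-1 *
    ((w - b)^-1 ^+ k.+2 + (-1) * ((w - b)^-1 ^+ k.+1 / (w - a))))).
  move=> w Sw; rewrite [(w - b)^-1 ^+ k.+2]exprS; field.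
  by rewrite ba0 !subr_eq0 !(off w).
by apply: RSscale; apply: RSadd; [exact: RSpole|exact: RSscale].
Qed.

Lemma horner_divX (p : {poly C}) z : exists d : {poly C},
  forall w, p.[w] = d.[w] * (w - z) + p.[z].
Proof.
have /factor_theorem [d pd] : root (p - p.[z]%:P) z.
  by rewrite /root hornerD hornerN hornerC subrr.
exists d => w; have := congr1 (fun q : {poly C} => q.[w]) pd.
rewrite hornerD hornerN hornerC hornerM hornerXsubC => <-.
by rewrite subrK.
Qed.

Lemma rational_span_div S f a : S a -> rational_span S f ->
  rational_span S (fun w => f w / (w - a)).
Proof.
move=> Sa; elim => [p|b k Sb|g h _ IHg _ IHh|b g _ IH|g h gh _ IH].
- have [d pd] := horner_divX p a.
  apply: (@RSext _ (fun w => d.[w] + p.[a] * (w - a)^-1 ^+ 1)).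
    move=> w Sw; rewrite (pd w) expr1; field.
    by rewrite subr_eq0; apply/eqP => wa; apply: Sw; rewrite wa.
  by apply: RSadd; [exact: RSpoly|apply: RSscale; exact: RSpole].
- exact: rational_span_pole.
- by apply: RSext (RSadd IHg IHh) => w _; rewrite mulrDl.
- by apply: RSext (RSscale b IH) => w _; rewrite mulrA.
- by apply: RSext IH => w Sw; rewrite gh.
Qed.

Lemma rational_spanP S (p q : {poly C}) : q != 0 ->
  (forall a, root q a -> S a) -> rational_span S (fun w => p.[w] / q.[w]).
Proof.
move=> q0 qS; have [r qr] := closed_field_poly_normal q.
have lq0 : lead_coef q != 0 by rewrite lead_coef_eq0.
have rS : {in r, forall a, S a}.
  by move=> a ar; apply: qS; rewrite qr rootZ// root_prod_XsubC.
apply: (@RSext _ (fun w => (lead_coef q)^-1 * (p.[w] / (\prod_(z <- r) ('X - z%:P)).[w]))).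
  move=> w Sw; rewrite [X in _ = _ / X.[w]]qr hornerZ invfM.
  by rewrite mulrCA.
apply: RSscale.
elim: r rS {qr} => [|a r IH] rS.
  by apply: RSext (RSpoly S p) => w _; rewrite big_nil hornerC divr1.
have Sa : S a by apply: rS; rewrite mem_head.
have rS' : {in r, forall a, S a} by move=> b br; apply: rS; rewrite inE br orbT.
apply: RSext (rational_span_div Sa (IH rS')) => w _.
by rewrite big_cons hornerM hornerXsubC invfM mulrCA [RHS]mulrC.
Qed.

End partial_fractions.

(** * Cauchy's formula *)

(** For u = 1 / (w - z'), v = 1 / (w - z) and d = z' - z, this bounds the second order
    Taylor remainder of the Cauchy kernel. *)
Lemma kernel_remainder (R : realType) (u v d : Cplx R) (D : R) n :
  normc u <= D -> normc v <= D -> u - v = d * u * v ->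
  normc (u ^+ n - v ^+ n - n%:R * d * v ^+ n.+1) <=
  n%:R * n.+1%:R * normc d ^+ 2 * D ^+ n.+2.
Proof.
move=> uD vD uv; have D0 : 0 <= D by rewrite (le_trans (mod_ge0 u)).
elim: n => [|n IH]; first by rewrite !expr0 subrr !mul0r subr0 mod0.
have -> : u ^+ n.+1 - v ^+ n.+1 - n.+1%:R * d * v ^+ n.+2 =
   u * (u ^+ n - v ^+ n - n%:R * d * v ^+ n.+1)
   + n.+1%:R * d ^+ 2 * (u * v ^+ n.+2).
  have e0 : u - v - d * u * v = 0 by rewrite uv subrr.
  rewrite !exprS -natr1; move: (u ^+ n) (v ^+ n) n%:R => x y N.
  rewrite -[RHS]addr0 -(mulr0 (y + (N + 1) * d * v * y)) -e0.
  by ring.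
apply: le_trans (ler_modD _ _) _.
have b1 : normc (u * (u ^+ n - v ^+ n - n%:R * d * v ^+ n.+1)) <=
   D * (n%:R * n.+1%:R * normc d ^+ 2 * D ^+ n.+2).
  by rewrite modM ler_pM ?mod_ge0.
have b2 : normc (n.+1%:R * d ^+ 2 * (u * v ^+ n.+2)) <=
   n.+1%:R * normc d ^+ 2 * (D * D ^+ n.+2).
  rewrite modM (modM _ (d ^+ 2)) (modM u) !modX mod_nat ler_wpM2l// ?mulr_ge0 ?exprn_ge0 ?mod_ge0//.
  by rewrite ler_pM ?exprn_ge0 ?mod_ge0// lerXn2r ?nnegrE ?mod_ge0.
apply: le_trans (lerD b1 b2) _.
have -> : D * (n%:R * n.+1%:R * normc d ^+ 2 * D ^+ n.+2) +
  n.+1%:R * normc d ^+ 2 * (D * D ^+ n.+2) =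
  n.+1%:R * n.+1%:R * (normc d ^+ 2 * D ^+ n.+3).
  by rewrite -[n.+1%:R in RHS]natr1 [D ^+ n.+3]exprS -natr1; ring.
have Q0 : 0 <= normc d ^+ 2 * D ^+ n.+3.
  by apply: mulr_ge0; apply: exprn_ge0 => //; exact: mod_ge0.
rewrite -[leRHS]mulrA; apply: ler_wpM2r => //.
by rewrite ler_wpM2l// ler_nat.
Qed.

Section contour.
Variable R : realType.
Local Notation C := (Cplx R).

Definition disjoint_discs (b b' : C * R) := b.2 + b'.2 < normc (b.1 - b'.1).

Variables (rho : R) (Bs : seq (C * R)).
Hypothesis rho_gt0 : 0 < rho.
Hypothesis Bs_gt0 : {in Bs, forall b, 0 < b.2}.
Hypothesis Bs_in : {in Bs, forall b, normc b.1 + b.2 < rho}.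
Hypothesis Bs_sep : pairwise disjoint_discs Bs.

Implicit Types (f h : C -> C) (w z a : C).

Definition contour_mean m h : C :=
  circle_mean m 0 rho h - \sum_(b <- Bs) circle_mean m b.1 b.2 h.

(** As a limit along an ultrafilter, this is defined, linear and bounded on all
    the functions which are bounded on the contour. *)
Definition contour_int h : C := ulim (fun m => contour_mean m h).

Definition on_circle (b : C * R) w := normc (w - b.1) = b.2.

Let circles : seq (C * R) := (0, rho) :: Bs.

Definition contour_bounded h := {in circles, forall b,
  exists M : R, forall w, on_circle b w -> normc (h w) <= M}.

Let circles_ge0 b : b \in circles -> 0 <= b.2.
Proof. by rewrite inE => /orP[/eqP ->|/Bs_gt0]; exact: ltW. Qed.

Let mean_bounded h b : b \in circles -> contour_bounded h ->
  bounded_seq (fun m => circle_mean m b.1 b.2 h).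
Proof.
move=> bc /(_ b bc) [M hM]; exists (b.2 * M) => m.
by apply: circle_mean_le => //; exact: circles_ge0.
Qed.

Let contour_mean_bounded h : contour_bounded h ->
  bounded_seq (fun m => contour_mean m h).
Proof.
move=> hb; apply: (@bounded_seqD _ (fun m => circle_mean m 0 rho h)).
  by have := @mean_bounded h (0, rho) (mem_head _ _) hb.
have : forall s, {subset s <= circles} ->
    bounded_seq (fun m => - \sum_(b <- s) circle_mean m b.1 b.2 h).
  elim=> [|b s IH] sc.
    by exists 0 => m; rewrite big_nil oppr0 mod0.
  have [M bM] := @mean_bounded h b (sc b (mem_head _ _)) hb.
  have [|M' sM] := IH; first by move=> x xs; apply: sc; rewrite inE xs orbT.
  exists (M + M') => m; rewrite big_cons opprD (le_trans (ler_modD _ _))//.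
  by rewrite lerD// modN.
by apply=> b bB; rewrite inE bB orbT.
Qed.

Lemma contour_intD h1 h2 : contour_bounded h1 -> contour_bounded h2 ->
  contour_int (fun w => h1 w + h2 w) = contour_int h1 + contour_int h2.
Proof.
move=> b1 b2; rewrite /contour_int -ulimD; [|exact: contour_mean_bounded..].
apply: eq_ulim => m; rewrite /contour_mean circle_meanD.
under eq_bigr do rewrite circle_meanD.
by rewrite big_split /= opprD addrACA.
Qed.

Lemma contour_intZ a h : contour_bounded h ->
  contour_int (fun w => a * h w) = a * contour_int h.
Proof.
move=> hb; rewrite /contour_int -ulimZ; last exact: contour_mean_bounded.
apply: eq_ulim => m; rewrite /contour_mean circle_meanZ.
under eq_bigr do rewrite circle_meanZ.
by rewrite -mulr_sumr mulrBr.
Qed.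

Lemma eq_contour_int h1 h2 :
  {in circles, forall b, forall w, on_circle b w -> h1 w = h2 w} ->
  contour_int h1 = contour_int h2.
Proof.
move=> h12; apply: eq_ulim => m; rewrite /contour_mean; congr (_ - _).
  by apply: eq_circle_mean; [exact: ltW|exact: (h12 (0, rho) (mem_head _ _))].
apply: eq_big_seq => b bB; apply: eq_circle_mean; first exact/ltW/Bs_gt0.
by apply: h12; rewrite inE bB orbT.
Qed.

Lemma contour_int_le h M0 (M : C * R -> R) :
  (forall w, normc w = rho -> normc (h w) <= M0) ->
  {in Bs, forall b, forall w, on_circle b w -> normc (h w) <= M b} ->
  normc (contour_int h) <= rho * M0 + \sum_(b <- Bs) b.2 * M b.
Proof.
move=> h0 hM; apply: ulim_le.
  apply: contour_mean_bounded => b; rewrite inE => /orP[/eqP ->|bB].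
    by exists M0 => w; rewrite /on_circle subr0; exact: h0.
  by exists (M b); exact: hM.
exists 0%N => m _; rewrite (le_trans (ler_modB _ _))// lerD//.
  by apply: circle_mean_le; [exact: ltW|move=> w; rewrite subr0; exact: h0].
apply: le_trans (ler_mod_sum _ _ _) _.
rewrite big_seq [leRHS]big_seq ler_sum// => b bB.
by apply: circle_mean_le; [exact/ltW/Bs_gt0|exact: hM].
Qed.


Definition outside_contour a :=
  rho < normc a \/ exists2 b, b \in Bs & normc (a - b.1) < b.2.

Definition inside_contour a :=
  normc a < rho /\ {in Bs, forall b, b.2 < normc (a - b.1)}.

Let sum_out (s : seq (C * R)) a k : {subset s <= Bs} ->
  {in s, forall b, b.2 < normc (a - b.1)} ->
  tends (fun m => \sum_(b <- s) circle_mean m b.1 b.2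
                    (fun w => (w - a)^-1 ^+ k.+1)) 0.
Proof.
elim: s => [|b s IH] sB sa.
  by apply: eq_tends (tends_cst 0) => m; rewrite big_nil.
rewrite -[X in tends _ X]addr0.
apply: (@eq_tends _ (fun m => circle_mean m b.1 b.2 (fun w => (w - a)^-1 ^+ k.+1) +
  \sum_(b <- s) circle_mean m b.1 b.2 (fun w => (w - a)^-1 ^+ k.+1))).
  by move=> m; rewrite big_cons.
apply: tendsD.
  by apply: circle_mean_pole_out; [exact/ltW/Bs_gt0/sB/mem_head|exact/sa/mem_head].
by apply: IH => x xs; [apply: sB|apply: sa]; rewrite inE xs orbT.
Qed.

Let sum_in (s : seq (C * R)) a k : {subset s <= Bs} -> pairwise disjoint_discs s ->
  (exists2 b, b \in s & normc (a - b.1) < b.2) ->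
  tends (fun m => \sum_(b <- s) circle_mean m b.1 b.2
                    (fun w => (w - a)^-1 ^+ k.+1)) (k == 0%N)%:R.
Proof.
elim: s => [|b s IH] sB; first by move=> _ [].
rewrite pairwise_cons => /andP[/allP bs ss] [b' b's ab'].
have sB' : {subset s <= Bs} by move=> x xs; apply: sB; rewrite inE xs orbT.
apply: (@eq_tends _ (fun m => circle_mean m b.1 b.2 (fun w => (w - a)^-1 ^+ k.+1) +
  \sum_(b <- s) circle_mean m b.1 b.2 (fun w => (w - a)^-1 ^+ k.+1))).
  by move=> m; rewrite big_cons.
move: b's; rewrite inE => /orP[/eqP bb|b's].
  rewrite -[X in tends _ X]addr0; apply: tendsD.
    by apply: circle_mean_pole_in; rewrite -bb.
  apply: sum_out => // x xs; have := bs x xs; rewrite /disjoint_discs -bb.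
  by have := ler_mod_dist a b'.1 x.1; rewrite [in normc (b'.1 - a)]modB; lra.
rewrite -[X in tends _ X]add0r; apply: tendsD; last by apply: IH => //; exists b'.
apply: circle_mean_pole_out; first exact/ltW/Bs_gt0/sB/mem_head.
have := bs b' b's; rewrite /disjoint_discs.
by have := ler_mod_dist a b.1 b'.1; rewrite [in normc (b.1 - a)]modB; lra.
Qed.

(** A pole in a hole contributes the same residue to the outer circle and to the
    boundary of this hole. *)
Lemma contour_int_outside a k : outside_contour a ->
  contour_int (fun w => (w - a)^-1 ^+ k.+1) = 0.
Proof.
move=> aout; apply: ulim_tends; case: aout => [ra|[b bB ab]].
  rewrite -[X in tends _ X]subr0; apply: tendsD.
    by apply: circle_mean_pole_out; [exact: ltW|rewrite subr0].
  apply: tendsN; apply: sum_out => // b bB.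
  have := Bs_in bB; have := ler_mod_sub a b.1; lra.
rewrite -(subrr (k == 0%N)%:R); apply: tendsD; last first.
  by apply: tendsN; apply: sum_in => //; exists b.
apply: circle_mean_pole_in; rewrite subr0.
have := Bs_in bB; have := ler_mod_sub a b.1; lra.
Qed.

Lemma contour_int_inside a k : inside_contour a ->
  contour_int (fun w => (w - a)^-1 ^+ k.+1) = (k == 0%N)%:R.
Proof.
move=> [ar aB]; apply: ulim_tends; rewrite -[X in tends _ X]subr0; apply: tendsD.
  by apply: circle_mean_pole_in; rewrite subr0.
by apply: tendsN; apply: sum_out.
Qed.

Lemma contour_int_poly (p : {poly C}) : contour_int (fun w => p.[w]) = 0.
Proof.
apply: ulim_tends; rewrite -[X in tends _ X]subr0; apply: tendsD.
  by apply: circle_mean_poly; exact: ltW.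
apply: tendsN.
have : forall s, {subset s <= Bs} ->
    tends (fun m => \sum_(b <- s) circle_mean m b.1 b.2 (fun w => p.[w])) 0.
  elim=> [|b s IH] sB.
    by apply: eq_tends (tends_cst 0) => m; rewrite big_nil.
  rewrite -[X in tends _ X]addr0.
  apply: (@eq_tends _ (fun m => circle_mean m b.1 b.2 (fun w => p.[w]) +
    \sum_(b <- s) circle_mean m b.1 b.2 (fun w => p.[w]))).
    by move=> m; rewrite big_cons.
  apply: tendsD; first by apply: circle_mean_poly; exact/ltW/Bs_gt0/sB/mem_head.
  by apply: IH => x xs; apply: sB; rewrite inE xs orbT.
exact.
Qed.

Let boundedD h1 h2 : contour_bounded h1 -> contour_bounded h2 ->
  contour_bounded (fun w => h1 w + h2 w).
Proof.
move=> b1 b2 b bc; have [M1 h1M] := b1 b bc; have [M2 h2M] := b2 b bc.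
exists (M1 + M2) => w wb; rewrite (le_trans (ler_modD _ _))// lerD//.
  exact: h1M.
exact: h2M.
Qed.

Let boundedM h1 h2 : contour_bounded h1 -> contour_bounded h2 ->
  contour_bounded (fun w => h1 w * h2 w).
Proof.
move=> b1 b2 b bc; have [M1 h1M] := b1 b bc; have [M2 h2M] := b2 b bc.
exists (M1 * M2) => w wb; rewrite modM ler_pM ?mod_ge0//.
  exact: h1M.
exact: h2M.
Qed.

Let bounded_cst a : contour_bounded (fun=> a).
Proof. by move=> b _; exists (normc a). Qed.

Let boundedX h k : contour_bounded h -> contour_bounded (fun w => h w ^+ k).
Proof.
move=> hb b bc; have [M hM] := hb b bc; exists (M ^+ k) => w wb.
rewrite modX lerXn2r ?nnegrE ?mod_ge0 ?hM//.
exact: le_trans (mod_ge0 _) (hM _ wb).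
Qed.

Let bounded_poly (p : {poly C}) : contour_bounded (fun w => p.[w]).
Proof.
move=> b bc; have [M _ pM] := mod_poly_le p (normc b.1 + b.2).
exists M => w wb; apply: pM.
by have := ler_modD (w - b.1) b.1; rewrite wb subrK; lra.
Qed.

Definition off_contour a := {in circles, forall b, normc (a - b.1) != b.2}.

Lemma outside_off a : outside_contour a -> off_contour a.
Proof.
move=> aout b; rewrite inE => /orP[/eqP ->/=|bB]; rewrite ?subr0.
  case: aout => [ar|[b' bB ab]]; first by rewrite gt_eqF.
  have := Bs_in bB; have := ler_mod_sub a b'.1 => h1 h2.
  by rewrite lt_eqF//; lra.
case: aout => [ar|[b' b'B ab]].
  have := Bs_in bB; have := ler_mod_sub a b.1 => h1 h2.
  by rewrite gt_eqF//; lra.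
have [<-|bb'] := eqVneq b' b; first by rewrite lt_eqF.
have sep : b.2 + b'.2 < normc (b.1 - b'.1).
  have := Bs_sep; elim: (Bs) bB b'B => // x s IH.
  rewrite pairwise_cons !inE => /orP[/eqP bx|bs] /orP[/eqP b'x|b's] /andP[/allP xs ss].
  - by rewrite bx b'x eqxx in bb'.
  - by have := xs _ b's; rewrite bx.
  - by have := xs _ bs; rewrite b'x /disjoint_discs addrC modB.
  - exact: IH.
rewrite gt_eqF//.
by have := ler_mod_dist a b.1 b'.1; rewrite [in normc (b.1 - a)]modB; lra.
Qed.

Lemma inside_off a : inside_contour a -> off_contour a.
Proof.
move=> [ar aB] b; rewrite inE => /orP[/eqP ->/=|bB]; rewrite ?subr0.
  by rewrite lt_eqF.
by rewrite gt_eqF// aB.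
Qed.

Lemma on_contour_neq a b w : off_contour a -> b \in circles -> on_circle b w ->
  w != a.
Proof.
move=> aoff /aoff ab wb; apply: contraNneq ab => <-.
by rewrite wb.
Qed.

Let bounded_pole a : off_contour a -> contour_bounded (fun w => (w - a)^-1).
Proof.
move=> aoff b bc; pose d := `|normc (a - b.1) - b.2|.
have d0 : 0 < d by rewrite normr_gt0 subr_eq0 aoff.
exists d^-1 => w wb; have wd : d <= normc (w - a).
  rewrite /d ler_norml -wb; apply/andP; split.
    by have := ler_mod_dist a w b.1; lra.
  by have := ler_mod_dist w a b.1; rewrite [in normc (a - w)]modB; lra.
by rewrite modV lef_pV2 ?posrE//; lra.
Qed.

(** By linearity the formula is checked on polynomials and on powers of
    1 / (w - a).  In both cases the difference quotient (f w - f z) / (w - z) is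
    a combination of functions of the same type, whose integrals vanish, and the
    integral of f z / (w - z) is f z. *)
Lemma cauchy_formula f z : inside_contour z -> rational_span outside_contour f ->
  contour_bounded f /\ contour_int (fun w => f w * (w - z)^-1) = f z.
Proof.
move=> zin; have zoff := inside_off zin.
have zb := bounded_pole zoff.
have int1 : contour_int (fun w => (w - z)^-1) = 1.
  rewrite -[RHS](contour_int_inside 0 zin).
  by apply: eq_contour_int => b _ w _; rewrite expr1.
elim=> [p|a k aout|g h _ [gb IHg] _ [hb IHh]|b g _ [gb IH]|g h gh _ [gb IH]].
- split; first exact: bounded_poly.
  have [d pd] := horner_divX p z.
  rewrite (@eq_contour_int _ (fun w => d.[w] + p.[z] * (w - z)^-1)); last first.
    move=> b bc w wb; rewrite (pd w); field.
    by rewrite subr_eq0; exact: on_contour_neq wb.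
  rewrite contour_intD//; last exact: boundedM.
  by rewrite contour_int_poly contour_intZ// int1 add0r mulr1.
- have aoff := outside_off aout; have ab := bounded_pole aoff.
  split; first exact: boundedX.
  have za : z - a != 0.
    rewrite subr_eq0; apply/eqP => za; move: zin aout; rewrite za => -[ar aB].
    by case=> [|[b /aB + ]]; [rewrite ltNge ltW|rewrite ltNge => /negbTE H /ltW; rewrite H].
  pose v := (z - a)^-1.
  have sumb n : contour_bounded
      (fun w => \sum_(i < n) v ^+ i.+1 * (w - a)^-1 ^+ (k.+1 - i)).
    elim: n => [|n IH].
      move=> b bc; exists 0 => w _; rewrite big_ord0 mod0//.
    move=> b bc; have [M hM] := boundedD IH
      (boundedM (bounded_cst (v ^+ n.+1)) (boundedX (k.+1 - n) ab)) bc.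
    by exists M => w wb; rewrite big_ord_recr /=; exact: hM.
  have sum0 n : (n <= k.+1)%N -> contour_int
      (fun w => \sum_(i < n) v ^+ i.+1 * (w - a)^-1 ^+ (k.+1 - i)) = 0.
    elim: n => [_|n IH nk].
      rewrite -[RHS](mul0r (contour_int (fun=> 0))) -contour_intZ//.
      by apply: eq_contour_int => b _ w _; rewrite big_ord0 mul0r.
    rewrite (@eq_contour_int _ (fun w =>
      \sum_(i < n) v ^+ i.+1 * (w - a)^-1 ^+ (k.+1 - i) +
      v ^+ n.+1 * (w - a)^-1 ^+ (k.+1 - n))); last first.
      by move=> b _ w _; rewrite big_ord_recr.
    rewrite contour_intD//; last exact: boundedM (bounded_cst _) (boundedX _ ab).
    rewrite IH ?(ltnW nk)// contour_intZ ?add0r; last exact: boundedX.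
    by rewrite subSn// contour_int_outside// mulr0.
  rewrite (@eq_contour_int _ (fun w => v ^+ k.+1 * (w - z)^-1 +
    (-1) * \sum_(i < k.+1) v ^+ i.+1 * (w - a)^-1 ^+ (k.+1 - i))); last first.
    move=> b bc w wb.
    have wz : w - z != 0 by rewrite subr_eq0; exact: on_contour_neq wb.
    have wa : w - a != 0 by rewrite subr_eq0; exact: on_contour_neq wb.
    have := subrXX (w - a)^-1 v k.+1.
    have -> : (w - a)^-1 - v = - (w - z) * ((w - a)^-1 * v).
      by rewrite /v; field; rewrite wa za.
    move=> /eqP; rewrite subr_eq => /eqP ->; rewrite mulrDl addrC; congr (_ + _).
    set A := (w - a)^-1; set S := (\sum_(i < _) _).
    have -> : - (w - z) * (A * v) * S / (w - z) = (-1) * ((A * v) * S) by field.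
    congr (_ * _); rewrite mulr_sumr; apply: eq_bigr => i _.
    rewrite subSn ?exprS; last by rewrite -ltnS.
    by rewrite /=; ring.
  rewrite contour_intD ?contour_intZ//; [|exact: boundedM..].
  by rewrite int1 mulr1 sum0// mulr0 addr0.
- split; first exact: boundedD.
  rewrite (@eq_contour_int _ (fun w => g w * (w - z)^-1 + h w * (w - z)^-1)).
    by rewrite contour_intD ?IHg ?IHh//; exact: boundedM.
  by move=> c _ w _; rewrite mulrDl.
- split; first exact: boundedM.
  rewrite (@eq_contour_int _ (fun w => b * (g w * (w - z)^-1))).
    by rewrite contour_intZ ?IH//; exact: boundedM.
  by move=> c _ w _; rewrite mulrA.
- have ghc : {in circles, forall b, forall w, on_circle b w -> g w = h w}.
    move=> b bc w wb; apply: gh => /outside_off /(_ b bc).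
    by rewrite wb eqxx.
  split.
    move=> b bc; have [M gM] := gb b bc; exists M => w wb.
    by rewrite -(ghc b bc w wb); exact: gM.
  rewrite -(@eq_contour_int (fun w => g w * (w - z)^-1)).
    rewrite IH; apply: gh => zout; have := zin; case: zout => [rz|[b bB zb']].
      by case=> + _; rewrite ltNge ltW.
    by case=> _ /(_ b bB); rewrite ltNge ltW.
  by move=> b bc w wb; rewrite (ghc b bc w wb).
Qed.


(** Cauchy's formula for the derivative of order [k]. *)
Definition cauchy_deriv f k z : C :=
  k`!%:R * contour_int (fun w => f w * (w - z)^-1 ^+ k.+1).

Section estimates.
Variables (f : C -> C) (M : R) (d0 : R) (d : C * R -> R) (z : C).
Hypothesis f_span : rational_span outside_contour f.
Hypothesis M_ge0 : 0 <= M.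
Hypothesis f_le : {in circles, forall b, forall w, on_circle b w -> normc (f w) <= M}.
Hypothesis d0_gt0 : 0 < d0.
Hypothesis d_gt0 : {in Bs, forall b, 0 < d b}.
Hypothesis z_in : inside_contour z.
Hypothesis d0_le : forall w, normc w = rho -> d0 <= normc (w - z).
Hypothesis d_le : {in Bs, forall b, forall w, on_circle b w -> d b <= normc (w - z)}.

Definition contour_weight n : R := rho / d0 ^+ n + \sum_(b <- Bs) b.2 / d b ^+ n.

Lemma cauchy_deriv0 : cauchy_deriv f 0 z = f z.
Proof.
rewrite /cauchy_deriv fact0 mul1r -(cauchy_formula z_in f_span).2.
by apply: eq_contour_int => b _ w _; rewrite expr1.
Qed.

(* the integral of f h when h is of the order of K / distance ^ n *)
Let int_le h K n :
  (forall w, normc w = rho -> normc (h w) <= K / d0 ^+ n) ->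
  {in Bs, forall b, forall w, on_circle b w -> normc (h w) <= K / d b ^+ n} ->
  normc (contour_int (fun w => f w * h w)) <= M * K * contour_weight n.
Proof.
move=> hK0 hK.
have -> : M * K * contour_weight n = rho * (M * (K / d0 ^+ n)) +
    \sum_(b <- Bs) b.2 * (M * (K / d b ^+ n)).
  rewrite /contour_weight mulrDr mulr_sumr; congr (_ + _).
    by move: (_^-1) => x; ring.
  by apply: eq_bigr => b _; move: (_^-1) => x; ring.
apply: contour_int_le => [w wr|b bB w wb].
  rewrite modM ler_pM ?mod_ge0//; last exact: hK0.
  by apply: (f_le (mem_head _ _)); rewrite /on_circle subr0.
rewrite modM ler_pM ?mod_ge0//; last exact: hK.
by apply: f_le wb; rewrite inE bB orbT.
Qed.

Let inv_le D w x : 0 < D -> D <= normc (w - x) -> normc (w - x)^-1 <= D^-1.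
Proof. by move=> D0 Dw; rewrite modV lef_pV2 ?posrE//; lra. Qed.

Lemma cauchy_deriv_le k :
  normc (cauchy_deriv f k z) <= k`!%:R * M * contour_weight k.+1.
Proof.
rewrite /cauchy_deriv modM mod_nat -mulrA ler_wpM2l//.
have pow_le D w : 0 < D -> D <= normc (w - z) ->
    normc ((w - z)^-1 ^+ k.+1) <= 1 / D ^+ k.+1.
  move=> D0 Dw; rewrite modX div1r -exprVn lerXn2r ?nnegrE ?mod_ge0 ?invr_ge0//.
    exact: ltW.
  exact: inv_le.
rewrite -[M in leRHS]mulr1; apply: int_le => [w wr|b bB w wb].
  by apply: pow_le => //; exact: d0_le.
by apply: pow_le; [exact: d_gt0|exact: d_le].
Qed.

Lemma cauchy_deriv_taylor k z' : inside_contour z' ->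
  (forall w, normc w = rho -> d0 <= normc (w - z')) ->
  {in Bs, forall b, forall w, on_circle b w -> d b <= normc (w - z')} ->
  normc (cauchy_deriv f k z' - cauchy_deriv f k z -
         (z' - z) * cauchy_deriv f k.+1 z) <=
  k.+2`!%:R * M * contour_weight k.+3 * normc (z' - z) ^+ 2.
Proof.
move=> z'_in d0_le' d_le'.
have fb := (cauchy_formula z_in f_span).1.
have zb := bounded_pole (inside_off z_in); have z'b := bounded_pole (inside_off z'_in).
pose h w := (w - z')^-1 ^+ k.+1 - (w - z)^-1 ^+ k.+1 -
  k.+1%:R * (z' - z) * (w - z)^-1 ^+ k.+2.
have -> : cauchy_deriv f k z' - cauchy_deriv f k z -
          (z' - z) * cauchy_deriv f k.+1 z =
          k`!%:R * contour_int (fun w => f w * h w).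
  have fzb j : contour_bounded (fun w => f w * (w - z)^-1 ^+ j).
    by apply: boundedM => //; exact: boundedX.
  have fz'b j : contour_bounded (fun w => f w * (w - z')^-1 ^+ j).
    by apply: boundedM => //; exact: boundedX.
  rewrite (@eq_contour_int _ (fun w => f w * (w - z')^-1 ^+ k.+1 +
    ((-1) * (f w * (w - z)^-1 ^+ k.+1) +
     (- (k.+1%:R * (z' - z))) * (f w * (w - z)^-1 ^+ k.+2)))); last first.
    by move=> b _ w _; rewrite /h; ring.
  have fcb c j : contour_bounded (fun w => c * (f w * (w - z)^-1 ^+ j)).
    by apply: boundedM => //; exact: fzb.
  rewrite contour_intD; [|exact: fz'b|by apply: boundedD; exact: fcb].
  rewrite contour_intD; [|exact: fcb|exact: fcb].
  rewrite contour_intZ; last exact: fzb.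
  rewrite contour_intZ; last exact: fzb.
  rewrite /cauchy_deriv factS natrM.
  set x1 := contour_int _; set x2 := contour_int _; set x3 := contour_int _.
  set F := k`!%:R; set N := k.+1%:R; move: F N x1 x2 x3 => F N x1 x2 x3.
  by ring.
rewrite modM mod_nat.
have -> : k.+2`!%:R * M * contour_weight k.+3 * normc (z' - z) ^+ 2 =
  k`!%:R * (M * (k.+1%:R * k.+2%:R * normc (z' - z) ^+ 2) * contour_weight k.+3).
  rewrite !factS !natrM; move: (k`!%:R : R) (k.+1%:R : R) (k.+2%:R : R) => F N N'.
  by ring.
rewrite ler_wpM2l//.
have ker_le D w : 0 < D -> D <= normc (w - z) -> D <= normc (w - z') ->
    normc (h w) <= k.+1%:R * k.+2%:R * normc (z' - z) ^+ 2 / D ^+ k.+3.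
  move=> D0 Dz Dz'; rewrite -exprVn; apply: kernel_remainder.
  - exact: inv_le.
  - exact: inv_le.
  - have wz : w - z != 0 by rewrite -mod_gt0; lra.
    have wz' : w - z' != 0 by rewrite -mod_gt0; lra.
    by field; rewrite wz wz'.
apply: int_le => [w wr|b bB w wb].
  by apply: ker_le => //; [exact: d0_le|exact: d0_le'].
by apply: ker_le; [exact: d_gt0|exact: d_le|exact: d_le'].
Qed.

End estimates.
End contour.

(** * Merging discs *)

Section merging.
Variable R : realType.
Local Notation C := (Cplx R).

(** A disc is given by its centre, its radius and a lower bound for the distance
    from its centre to the compact set under consideration. *)
Local Notation disc := (C * R * R)%type.
Local Notation cluster := ((C * R) * seq disc)%type.

(** A cluster is a disc together with the discs it has been made of. *)
Definition cluster_ok (g : cluster) :=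
  [/\ g.2 != [::], g.1.2 = \sum_(x <- g.2) x.1.2, 0 < g.1.2 &
      {in g.2, forall x : disc, normc (x.1.1 - g.1.1) + x.1.2 <= g.1.2}].

Let sep (g g' : cluster) := disjoint_discs g.1 g'.1.
Let members (G : seq cluster) := flatten [seq g.2 | g <- G].

(** The centre is the barycentre of the centres with weights the radii: its
    distance to either of them is at most the radius of the other disc. *)
Lemma merge_clusters (g g' : cluster) : cluster_ok g -> cluster_ok g' ->
  ~~ sep g g' -> exists2 h, cluster_ok h & h.2 = g.2 ++ g'.2.
Proof.
case: g g' => [[c r] s] [[c' r'] s'] [/= s0 rs r0 sc] [/= s0' rs' r0' sc'].
rewrite /sep /disjoint_discs /= -leNgt => cc.
have rr0 : 0 < r + r' by lra.
have rC0 : ((r + r')%:C)%C != 0 :> C by rewrite -mod_gt0 mod_real_ge0 ?ltW.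
pose m : C := ((r%:C)%C * c + (r'%:C)%C * c') / ((r + r')%:C)%C.
have rCD : ((r + r')%:C)%C = (r%:C)%C + (r'%:C)%C :> C by rewrite rmorphD.
have cm : normc (c - m) <= r'.
  have -> : c - m = (r'%:C)%C * (c - c') / ((r + r')%:C)%C.
    by rewrite /m; move: rC0; rewrite rCD => H; field.
  rewrite mod_div modM !mod_real_ge0 ?(ltW r0') ?(ltW rr0)//.
  by rewrite ler_pdivrMr// ler_pM2l.
have cm' : normc (c' - m) <= r.
  have -> : c' - m = (r%:C)%C * (c' - c) / ((r + r')%:C)%C.
    by rewrite /m; move: rC0; rewrite rCD => H; field.
  rewrite mod_div modM !mod_real_ge0 ?(ltW r0) ?(ltW rr0)// modB.
  by rewrite ler_pdivrMr// ler_pM2l.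
exists ((m, r + r'), s ++ s') => //; split => //=.
- by case: (s) s0.
- by rewrite big_cat /= -rs -rs'.
- move=> x; rewrite mem_cat => /orP[/sc|/sc'] => h.
    by have := ler_mod_dist x.1.1 c m; have := ler_mod_dist c x.1.1 m; lra.
  by have := ler_mod_dist c' x.1.1 m; lra.
Qed.

Lemma cluster_insert G g : {in G, forall h : cluster, cluster_ok h} -> pairwise sep G ->
  cluster_ok g ->
  exists G', [/\ {in G', forall h : cluster, cluster_ok h}, pairwise sep G' &
                 perm_eq (members G') (g.2 ++ members G)].
Proof.
have [n] := ubnP (size G); elim: n G g => // n IH G g.
rewrite ltnS => Gn Gok Gsep gok.
have [/hasP[g' g'G ng]|/hasPn nG] := boolP (has (fun g' => ~~ sep g g') G); last first.
  exists (g :: G); split => //.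
    by move=> h; rewrite inE => /orP[/eqP ->//|]; exact: Gok.
  rewrite /= Gsep andbT; apply/allP => h /nG.
  by rewrite negbK.
have [h hok hs] := merge_clusters gok (Gok _ g'G) ng.
have sub := rem_subseq g' G.
have [||||G' [G'ok G'sep G'p]] := IH (rem g' G) h.
- rewrite size_rem//; case: (G) g'G Gn => // x s _ /=.
- by move=> x /(mem_subseq sub); exact: Gok.
- exact: subseq_pairwise Gsep.
- by [].
exists G'; split => //; apply: perm_trans G'p _.
rewrite hs -catA perm_cat2l perm_sym.
have := perm_flatten (perm_map (fun g : cluster => g.2) (perm_to_rem g'G)).
by [].
Qed.

(** Discs which meet are merged as long as there are any; each step lowers the
    number of clusters and preserves the sum of the radii. *)
Lemma clusters (L : seq disc) : {in L, forall x : disc, 0 < x.1.2} ->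
  exists G, [/\ {in G, forall h : cluster, cluster_ok h}, pairwise sep G &
                perm_eq (members G) L].
Proof.
elim: L => [|x L IH] L0; first by exists [::].
have [|G [Gok Gsep Gp]] := IH; first by move=> y yL; apply: L0; rewrite inE yL orbT.
have xok : cluster_ok (x.1, [:: x]).
  split => //=; first by rewrite big_seq1.
    by apply: L0; rewrite mem_head.
  by move=> y; rewrite inE => /eqP ->; rewrite subrr mod0 add0r.
have [G' [G'ok G'sep G'p]] := cluster_insert Gok Gsep xok.
exists G'; split => //; apply: perm_trans G'p _.
by rewrite /= perm_cons.
Qed.

(** If [b] lies in one of the intervals, it is moved just to the left of it, at the
    cost of the length of this interval. *)
Lemma interval_avoid (I : seq (R * R)) (a b : R) :
  {in I, forall i, 0 < i.2} -> 2 * \sum_(i <- I) i.2 < b - a ->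
  exists t, [/\ a < t, t <= b &
    {in I, forall i, i.1 + i.2 < t \/ t < i.1 - i.2}].
Proof.
have [n] := ubnP (size I); elim: n I b => // n IH I b.
rewrite ltnS => In I0 ab.
have sum0 (J : seq (R * R)) : {in J, forall i, 0 < i.2} -> 0 <= \sum_(i <- J) i.2.
  by move=> J0; rewrite big_seq sumr_ge0// => i /J0 /ltW.
have [/hasP[i iI]|/hasPn nI] :=
  boolP (has (fun i => (i.1 - i.2 <= b) && (b <= i.1 + i.2)) I); last first.
  exists b; split => //; first by have := sum0 _ I0; lra.
  move=> i /nI; rewrite negb_and -!ltNge => /orP[h|h]; [by right|by left].
move=> /andP[ib bi].
have sub := mem_subseq (rem_subseq i I).
move: ab; rewrite (perm_big _ (perm_to_rem iI)) big_cons /= => ab.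
set S := \sum_(j <- rem i I) j.2 in ab.
pose e := (b - a - 2 * (i.2 + S)) / 2.
have [|||t [at_ tb tI]] := IH (rem i I) (i.1 - i.2 - e).
- rewrite size_rem//; case: (I) iI In => // x s _ /=.
- by move=> j /sub; exact: I0.
- by rewrite -/S /e; lra.
exists t; split => //; first by rewrite /e in tb; lra.
move=> j; rewrite (perm_mem (perm_to_rem iI)) inE => /orP[/eqP ->|/tI//].
by right; rewrite /e in tb; lra.
Qed.

End merging.

Section stage.
Variable R : realType.
Local Notation C := (Cplx R).
Local Notation disc := (C * R * R)%type.
Local Notation cluster := ((C * R) * seq disc)%type.

Lemma seq_argmax (T : eqType) (f : T -> R) (s : seq T) : s != [::] ->
  exists2 x, x \in s & {in s, forall y, f y <= f x}.
Proof.
elim: s => // x [|y s] IH _; first by exists x; rewrite ?mem_head// => z; rewrite inE => /eqP ->.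
have [//|m ms mM] := IH.
have [xm|/ltW mx] := leP (f x) (f m).
  exists m; first by rewrite inE ms orbT.
  by move=> z; rewrite inE => /orP[/eqP ->//|]; exact: mM.
exists x; first exact: mem_head.
move=> z; rewrite inE => /orP[/eqP ->//|/mM zm].
exact: le_trans mx.
Qed.

Lemma disjoint_discs_uniq (G : seq cluster) :
  {in G, forall g : cluster, 0 < g.1.2} ->
  pairwise (fun g g' : cluster => disjoint_discs g.1 g'.1) G ->
  uniq [seq g.1 | g <- G].
Proof.
elim: G => // g G IH G0; rewrite pairwise_cons => /andP[/allP gG sG] /=.
rewrite IH// ?andbT; last by move=> h hG; apply: G0; rewrite inE hG orbT.
apply/mapP => -[h hG gh]; have := gG h hG.
rewrite /disjoint_discs -gh subrr mod0 ltNge => /negP; apply.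
by rewrite addr_ge0// ltW// G0// mem_head.
Qed.

Variables (L : seq disc) (K : set C) (eta : R).
Hypothesis eta_gt0 : 0 < eta.
Hypothesis eta_lt1 : eta < 1.
Hypothesis L_gt0 : (forall x : disc, x \in L -> 0 < x.1.2).
Hypothesis delta_gt0 : (forall x : disc, x \in L -> 0 < x.2).
Hypothesis delta_le : (forall x : disc, x \in L -> forall z, K z -> x.2 <= normc (x.1.1 - z)).
Hypothesis K_in : forall z, K z -> normc z <= 1 - 2 * eta.
Hypothesis L_small : \sum_(x <- L) x.1.2 < eta / 2.
Hypothesis L_thin : \sum_(x <- L) x.1.2 / x.2 <= 4^-1.

Definition disc_weight n : R := eta^-1 ^+ n + \sum_(x <- L) x.1.2 * (2 / x.2) ^+ n.

Let sum_sub (G : seq cluster) g (phi : disc -> R) :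
  g \in G -> perm_eq (flatten [seq g.2 | g <- G]) L ->
  (forall x : disc, x \in L -> 0 <= phi x) ->
  \sum_(x <- g.2) phi x <= \sum_(x <- L) phi x.
Proof.
move=> gG GL phi0; rewrite -(perm_big _ GL) big_flatten big_map /=.
have GL' h x : h \in G -> x \in h.2 -> x \in L.
  move=> hG xh; rewrite -(perm_mem GL); apply/flattenP; exists h.2 => //.
  exact: map_f.
rewrite (perm_big _ (perm_to_rem gG)) big_cons lerDl.
rewrite big_seq sumr_ge0// => h hG; rewrite big_seq sumr_ge0// => x xh.
by apply/phi0/(GL' h x) => //; exact: (mem_subseq (rem_subseq g G)).
Qed.

(* the number t is the largest distance to [K] among the members of the cluster *)
Let cluster_dist (G : seq cluster) g : g \in G -> cluster_ok g ->
  perm_eq (flatten [seq g.2 | g <- G]) L ->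
  exists t, [/\ 0 < t,
    forall z w, K z -> normc (w - g.1.1) <= g.1.2 -> t / 2 <= normc (w - z) &
    forall n, g.1.2 / (t / 2) ^+ n <= \sum_(x <- g.2) x.1.2 * (2 / x.2) ^+ n].
Proof.
move=> gG [g0 gr gpos gsub] GL.
have gL x : x \in g.2 -> x \in L.
  move=> xg; rewrite -(perm_mem GL); apply/flattenP; exists g.2 => //.
  exact: map_f.
have [m mg mM] := @seq_argmax _ (fun x : disc => x.2) g.2 g0.
have m0 : 0 < m.2 by exact/delta_gt0/gL.
have small : g.1.2 <= m.2 / 4.
  rewrite gr; apply: (@le_trans _ _ (m.2 * \sum_(x <- g.2) x.1.2 / x.2)).
    rewrite mulr_sumr big_seq [leRHS]big_seq ler_sum// => x xg.
    have x0 := delta_gt0 (gL _ xg); have r0 := L_gt0 (gL _ xg).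
    rewrite mulrCA ler_peMr ?(ltW r0)// ler_pdivlMr// mul1r.
    exact: mM.
  rewrite ler_wpM2l ?(ltW m0)//; apply: le_trans L_thin.
  apply: sum_sub gG GL _ => // x xL.
  by rewrite divr_ge0// ltW// ?L_gt0// delta_gt0.
exists m.2; split => //.
  move=> z w Kz wg; have := delta_le (gL _ mg) Kz; have := gsub _ mg.
  have := L_gt0 (gL _ mg).
  have := ler_mod_dist w m.1.1 z; have := ler_mod_dist g.1.1 m.1.1 w.
  rewrite [in normc (m.1.1 - w)]modB [in normc (g.1.1 - w)]modB.
  lra.
move=> n; rewrite gr mulr_suml big_seq [leRHS]big_seq ler_sum// => x xg.
have x0 := delta_gt0 (gL _ xg); have r0 := L_gt0 (gL _ xg).
rewrite ler_wpM2l ?(ltW r0)// -exprVn invf_div.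
rewrite lerXn2r ?nnegrE ?divr_ge0 ?(ltW x0) ?(ltW m0)//.
by rewrite ler_pM2l// lef_pV2 ?posrE// mM.
Qed.

(** The contour consists of the boundaries of the merged discs and of a circle
    between the radii 1 - eta and 1 which avoids them.  A merged disc has radius at most
    a quarter of the largest distance d to [K] among its members, so that its
    points are at distance at least d / 2 from [K]. *)
Lemma cauchy_estimates (p q : {poly C}) (M : R) : 0 <= M ->
  (forall w : C, normc w <= 1 -> (forall x : disc, x \in L -> x.1.2 <= normc (w - x.1.1)) ->
     q.[w] != 0 /\ normc (p.[w] / q.[w]) <= M) ->
  exists G : nat -> C -> C,
  [/\ forall z, K z -> G 0%N z = p.[z] / q.[z],
      forall k z, K z -> normc (G k z) <= k`!%:R * M * disc_weight k.+1 &
      forall k z z', K z -> K z' ->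
        normc (G k z' - G k z - (z' - z) * G k.+1 z) <=
        k.+2`!%:R * M * disc_weight k.+3 * normc (z' - z) ^+ 2].
Proof.
move=> M0 pq; have [G [Gok Gsep GL]] := clusters L_gt0.
have Gsum (phi : disc -> R) :
    \sum_(x <- L) phi x = \sum_(g <- G) \sum_(x <- g.2) phi x.
  by rewrite -(perm_big _ GL) big_flatten big_map.
have G0 : {in G, forall g : cluster, 0 < g.1.2} by move=> g /Gok [].
have [||rho [rho1 rho2 rhoG]] :=
    @interval_avoid R [seq (normc g.1.1, g.1.2) | g <- G] (1 - eta) 1.
- by move=> i /mapP[g gG ->]; exact: G0.
- rewrite big_map /=.
  have -> : \sum_(g <- G) g.1.2 = \sum_(x <- L) x.1.2.
    rewrite Gsum; apply: eq_big_seq => g gG.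
    by have [_ -> _ _] := Gok _ gG.
  by rewrite subKr mulrC -ltr_pdivlMr.
have rhoG' g : g \in G -> normc g.1.1 + g.1.2 < rho \/ rho < normc g.1.1 - g.1.2.
  by move=> gG; apply: (rhoG (normc g.1.1, g.1.2)); apply/mapP; exists g.
have rho0 : 0 < rho by apply: lt_trans rho1; rewrite subr_gt0.
pose G' := [seq g <- G | normc g.1.1 + g.1.2 < rho].
pose Bs := [seq g.1 | g <- G'].
have G'G (g : cluster) : g \in G' -> g \in G by rewrite mem_filter => /andP[].
have memBs (b : C * R) : b \in Bs -> exists2 g : cluster, g \in G' & b = g.1 by move=> /mapP.
have Bs0 : {in Bs, forall b : C * R, 0 < b.2}.
  by move=> b /memBs [g /G'G gG ->]; exact: G0.
have Bsin : {in Bs, forall b : C * R, normc b.1 + b.2 < rho}.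
  by move=> b /memBs [g + ->]; rewrite mem_filter => /andP[].
have G'sep : pairwise (fun g g' : cluster => disjoint_discs g.1 g'.1) G'.
  exact: pairwise_filter.
have Bssep : pairwise (@disjoint_discs R) Bs.
  by rewrite pairwise_map; exact: G'sep.
have Bsuniq : uniq Bs by apply: disjoint_discs_uniq => // g /G'G; exact: G0.
have Lmem (x : disc) : x \in L -> exists2 g : cluster, g \in G & x \in g.2.
  by rewrite -(perm_mem GL) => /flattenP [s /mapP[g gG ->] xs]; exists g.
(* the points of the contour are in the domain of the bound *)
have off (w : C) : normc w <= 1 -> (forall g, g \in G -> g.1.2 <= normc (w - g.1.1)) ->
    q.[w] != 0 /\ normc (p.[w] / q.[w]) <= M.
  move=> w1 wG; apply: pq => // x /Lmem [g gG xg].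
  have [_ _ _ /(_ x xg)] := Gok _ gG; have := wG g gG.
  by have := ler_mod_dist x.1.1 w g.1.1; lra.
have off0 (w : C) : normc w = rho -> q.[w] != 0 /\ normc (p.[w] / q.[w]) <= M.
  move=> wr; apply: off; first by rewrite wr.
  move=> g /rhoG' [h|h]; first by have := ler_mod_sub w g.1.1; lra.
  by have := ler_mod_sub g.1.1 w; rewrite modB; lra.
have offB : {in Bs, forall b : C * R, forall w : C, on_circle b w ->
    q.[w] != 0 /\ normc (p.[w] / q.[w]) <= M}.
  move=> b bB w wb; apply: off.
    have := Bsin b bB; have := ler_modD (w - b.1) b.1.
    by rewrite subrK wb; lra.
  have [g gG' bg] := memBs _ bB; rewrite /on_circle bg in wb.
  move=> h hG; have [<-|gh] := eqVneq g h; first by rewrite wb.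
  have sep : g.1.2 + h.1.2 < normc (g.1.1 - h.1.1).
    have := Gsep; have := G'G _ gG'.
    elim: (G) hG => // x s IH.
    rewrite pairwise_cons !inE => /orP[/eqP hx|hs] /orP[/eqP gx|gs] /andP[/allP xs ss].
    - by rewrite hx gx eqxx in gh.
    - by have := xs _ gs; rewrite /disjoint_discs hx addrC modB.
    - by have := xs _ hs; rewrite /disjoint_discs gx.
    - exact: IH.
  by have := ler_mod_dist w g.1.1 h.1.1; rewrite [in normc (g.1.1 - w)]modB wb; lra.
have q0 : q != 0.
  apply: contraTneq (off0 ((rho%:C)%C) (mod_real_ge0 (ltW rho0))).1 => ->.
  by rewrite horner0 eqxx.
have poles (a : C) : root q a -> outside_contour rho Bs a.
  move=> /rootP qa.
  have [rg|ga] := ltP rho (normc a); first by left.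
  have [/hasP[g gG ag]|/hasPn nag] :=
      boolP (has (fun g : cluster => normc (a - g.1.1) < g.1.2) G); last first.
    have [|g /nag|+ _] := off a; first lra.
      by rewrite -leNgt.
    by rewrite qa eqxx.
  case: (rhoG' g gG) => h; last by left; have := ler_mod_sub g.1.1 a; rewrite modB; lra.
  by right; exists g.1 => //; apply: map_f; rewrite mem_filter h.
have span := rational_spanP p q0 poles.
have [t tP] : exists t : cluster -> R, {in G, forall g : cluster, [/\ 0 < t g,
    forall z w, K z -> normc (w - g.1.1) <= g.1.2 -> t g / 2 <= normc (w - z) &
    forall n, g.1.2 / (t g / 2) ^+ n <= \sum_(x <- g.2) x.1.2 * (2 / x.2) ^+ n]}.
  have ex (g : cluster) : exists t, g \in G -> [/\ 0 < t,
      forall z w, K z -> normc (w - g.1.1) <= g.1.2 -> t / 2 <= normc (w - z) &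
      forall n, g.1.2 / (t / 2) ^+ n <= \sum_(x <- g.2) x.1.2 * (2 / x.2) ^+ n].
    have [gG|gG] := boolP (g \in G); last by exists 0.
    by have [t tP] := cluster_dist gG (Gok _ gG) GL; exists t.
  by have [t tP] := choice ex; exists t.
pose d b := t (nth ((0, 0), [::]) G' (index b Bs)) / 2.
have dE (g : cluster) : g \in G' -> d g.1 = t g / 2.
  move=> gG'; rewrite /d; congr (t _ / 2).
  have gi : (index g G' < size G')%N by rewrite index_mem.
  have -> : g.1 = nth (0, 0) Bs (index g G').
    by rewrite (nth_map ((0, 0), [::]))// nth_index.
  by rewrite index_uniq ?size_map// nth_index.
have d_gt0 : {in Bs, forall b : C * R, 0 < d b}.
  move=> b /memBs [g gG' ->]; rewrite dE//.
  by have [t0 _ _] := tP g (G'G _ gG'); rewrite divr_gt0.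
have d0_le (z w : C) : K z -> normc w = rho -> eta <= normc (w - z).
  by move=> /K_in Kz wr; have := ler_mod_sub w z; lra.
have d_le (z : C) : K z -> {in Bs, forall b : C * R, forall w : C, on_circle b w -> d b <= normc (w - z)}.
  move=> Kz b /memBs [g gG' ->] w wb; rewrite dE//.
  have [_ h _] := tP g (G'G _ gG'); apply: h => //.
  by rewrite -wb.
have inK (z : C) : K z -> inside_contour rho Bs z.
  move=> Kz; split; first by have := K_in Kz; lra.
  move=> b /memBs [g gG' ->]; rewrite ltNge; apply/negP => zg.
  have [t0 h _] := tP g (G'G _ gG').
  by have := h z z Kz zg; rewrite subrr mod0; lra.
have f_le : {in (0, rho) :: Bs, forall b : C * R, forall w : C, on_circle b w ->
    normc (p.[w] / q.[w]) <= M}.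
  move=> b; rewrite inE => /orP[/eqP ->|bB] w wb; last exact: (offB b bB w wb).2.
  by apply: (off0 w _).2; move: wb; rewrite /on_circle subr0.
have weight_le n : contour_weight rho Bs eta d n <= disc_weight n.
  rewrite /contour_weight /disc_weight lerD//.
    rewrite exprVn ler_piMl// invr_ge0 exprn_ge0// ltW//.
  rewrite /Bs big_map.
  have -> : \sum_(g <- G') g.1.2 / d g.1 ^+ n = \sum_(g <- G') g.1.2 / (t g / 2) ^+ n.
    by apply: eq_big_seq => g gG'; rewrite dE.
  rewrite Gsum /G' big_filter.
  apply: (@le_trans _ _ (\sum_(g <- G | normc g.1.1 + g.1.2 < rho)
       \sum_(x <- g.2) x.1.2 * (2 / x.2) ^+ n)).
    rewrite big_seq_cond [leRHS]big_seq_cond ler_sum// => g /andP[gG _].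
    by have [_ _ h] := tP g gG; exact: h.
  rewrite [leRHS](bigID (fun g : cluster => normc g.1.1 + g.1.2 < rho)) /= lerDl.
  rewrite big_seq_cond sumr_ge0// => g /andP[gG _].
  rewrite big_seq sumr_ge0// => x xg.
  have xL : x \in L.
    rewrite -(perm_mem GL); apply/flattenP; exists g.2 => //.
    exact: map_f.
  by rewrite mulr_ge0 ?exprn_ge0 ?divr_ge0// ltW ?L_gt0// delta_gt0.
exists (fun k z => cauchy_deriv rho Bs (fun w => p.[w] / q.[w]) k z); split.
- move=> z Kz; exact: (cauchy_deriv0 rho0 Bs0 Bsin Bssep span (inK z Kz)).
- move=> k z Kz.
  have h := cauchy_deriv_le rho0 Bs0 f_le eta_gt0
    d_gt0 (fun w => @d0_le z w Kz) (d_le z Kz) k.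
  apply: (le_trans h).
  by rewrite ler_wpM2l// mulr_ge0.
- move=> k z z' Kz Kz'.
  have h := cauchy_deriv_taylor rho0 Bs0 Bsin Bssep span f_le eta_gt0
    d_gt0 (inK z Kz) (fun w => @d0_le z w Kz) (d_le z Kz) k (inK z' Kz')
    (fun w => @d0_le z' w Kz') (d_le z' Kz').
  apply: (le_trans h).
  by rewrite ler_wpM2r ?exprn_ge0 ?mod_ge0// ler_wpM2l// mulr_ge0.
Qed.

End stage.

(** * Passing to the limit on a Swiss cheese *)

Section limits.
Variable R : realType.
Local Notation C := (Cplx R).
Local Notation disc := (C * R * R)%type.

Lemma poly_continuous_at (p : {poly C}) (z : C) (e : R) : 0 < e ->
  exists2 d : R, 0 < d & forall w : C, normc (w - z) < d -> normc (p.[w] - p.[z]) < e.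
Proof.
move=> e0; have [b pb] := horner_divX p z.
have [M M0 bM] := mod_poly_le b (normc z + 1).
have d0 : 0 < Num.min 1 (e / M) by rewrite lt_min ltr01 divr_gt0.
exists (Num.min 1 (e / M)) => // w; rewrite lt_min => /andP[w1 we].
rewrite pb addrK modM; have bw : normc b.[w] <= M.
  by apply: bM; have := ler_modD (w - z) z; rewrite subrK; lra.
rewrite (@le_lt_trans _ _ (M * normc (w - z)))//.
  by rewrite ler_wpM2r// mod_ge0.
by rewrite mulrC -ltr_pdivlMr.
Qed.

Lemma closed_poly_le (p q : {poly C}) (a b : R) : 0 <= a ->
  closed [set w : C | a * normc q.[w] <= normc p.[w] + b].
Proof.
move=> a0; rewrite closedE => z nz; apply: contrapT => /negP.
rewrite -ltNge => lt; apply: nz; apply/nbhs_modP.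
pose e := (a * normc q.[z] - (normc p.[z] + b)) / (2 * (a + 1)).
have e0 : 0 < e by rewrite divr_gt0// ?subr_gt0// mulr_gt0//; lra.
have eE : 2 * (a + 1) * e = a * normc q.[z] - (normc p.[z] + b).
  by rewrite /e mulrCA divff ?mulr1//; lra.
have [d1 d10 h1] := poly_continuous_at p z e0.
have [d2 d20 h2] := poly_continuous_at q z e0.
exists (Num.min d1 d2); first by rewrite lt_min d10.
move=> w; rewrite lt_min => /andP[/h1 pw /h2 qw]; apply/negP; rewrite -ltNge.
have := ler_mod_sub p.[w] p.[z]; have := ler_mod_sub q.[z] q.[w].
rewrite [in normc (q.[z] - _)]modB => h3 h4.
have : a * (normc q.[z] - normc q.[w]) <= a * e by rewrite ler_wpM2l//; lra.
rewrite mulrBr; nra.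
Qed.

Lemma closed_mod_ge (c : C) (r : R) : closed [set w : C | r <= normc (w - c)].
Proof.
have cl := @closed_poly_le ('X - c%:P) 1 r 0.
have [r0|r0] := leP 0 r.
  have := cl r0; congr closed; apply/seteqP; split => w /=;
  by rewrite hornerC mod1 hornerXsubC mulr1 addr0.
rewrite (_ : [set w : C | _] = setT); first exact: closedT.
apply/seteqP; split => w //= _; exact: le_trans (ltW r0) (mod_ge0 _).
Qed.

Lemma bounded_in_disc (u : nat -> C) : (forall n, normc (u n) <= 1) -> bounded_seq u.
Proof. by exists 1. Qed.

Section cheese.
Variables (D : nat -> seq disc) (K : set C) (eta : R) (W : nat -> R).

Let L A := flatten [seq D a | a <- iota 0 A].

Definition cheese : set C := [set w | normc w <= 1 /\
  forall a (x : disc), x \in D a -> x.1.2 <= normc (w - x.1.1)].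

Let mem_L A (x : disc) : x \in L A -> exists a, x \in D a.
Proof. by move=> /flattenP [s /mapP[a _ ->] xa]; exists a. Qed.

Hypothesis eta_gt0 : 0 < eta.
Hypothesis eta_lt1 : eta < 1.
Hypothesis D_gt0 : forall a (x : disc), x \in D a -> 0 < x.1.2.
Hypothesis delta_gt0 : forall a (x : disc), x \in D a -> 0 < x.2.
Hypothesis delta_le : forall a (x : disc), x \in D a ->
  forall z : C, K z -> x.2 <= normc (x.1.1 - z).
Hypothesis K_in : forall z : C, K z -> normc z <= 1 - 2 * eta.
Hypothesis D_small : forall A, \sum_(x <- L A) x.1.2 < eta / 2.
Hypothesis D_thin : forall A, \sum_(x <- L A) x.1.2 / x.2 <= 4^-1.
Hypothesis D_weight : forall A n,
  \sum_(x <- L A) x.1.2 * (2 / x.2) ^+ n.+1 <= W n.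

Lemma cheese_sub_limit (u : nat -> C) :
  (forall n, normc (u n) <= 1 /\
     forall x : disc, x \in L n -> x.1.2 <= normc (u n - x.1.1)) ->
  bounded_seq u /\ cheese (ulim u).
Proof.
move=> uP; have bu : bounded_seq u by apply: bounded_in_disc => n; exact: (uP n).1.
split => //; split.
  apply: ulim_le => //; exists 0%N => n _; exact: (uP n).1.
move=> a x xa; apply: (ulim_closed (@closed_mod_ge x.1.1 x.1.2)) => //.
exists a.+1 => n an; apply: (uP n).2; apply/flattenP; exists (D a) => //.
by apply: map_f; rewrite mem_iota.
Qed.

Lemma compact_cheese : compact cheese.
Proof.
apply: (subclosed_compact _ (@compact_disc R 0 1)); last first.
  by move=> w [w1 _]; rewrite /closed_disc /= subr0.
have -> : cheese = closed_disc 0 1 `&`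
    \bigcap_a \bigcap_(x in [set` D a]) [set w : C | x.1.2 <= normc (w - x.1.1)].
  apply/seteqP; split => [w [w1 wD]|w [w1 wD]].
    by split; [rewrite /closed_disc /= subr0|move=> a _ x; exact: wD].
  split; first by move: w1; rewrite /closed_disc /= subr0.
  by move=> a x xa; exact: (wD a I x xa).
apply: closedI; first exact: closed_mod_le.
by apply: closed_bigI => a _; apply: closed_bigI => x _; exact: closed_mod_ge.
Qed.

Lemma cheese_poly_ge (q : {poly C}) : (forall z : C, cheese z -> q.[z] != 0) ->
  exists2 c : R, 0 < c & forall z : C, cheese z -> c <= normc q.[z].
Proof.
move=> q0; apply: contrapT => nc.
have ex n : exists z : C, cheese z /\ normc q.[z] <= n.+1%:R^-1.
  apply: contrapT => nz; apply: nc; exists n.+1%:R^-1; first by rewrite invr_gt0.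
  move=> z Xz; rewrite leNgt; apply/negP => qz; apply: nz; exists z.
  by split => //; exact: ltW.
have [u uP] := choice ex.
have [bu Xu] : bounded_seq u /\ cheese (ulim u).
  apply: cheese_sub_limit => n; have [[u1 uD] _] := uP n; split => // x.
  by move=> /mem_L [a]; exact: uD.
have := q0 _ Xu; rewrite -mod_gt0 => qu0.
have [n qn] : exists n, n.+1%:R^-1 < normc q.[ulim u].
  have [n hn] : exists n : nat, (normc q.[ulim u])^-1 < n%:R.
    exists (Num.truncn (normc q.[ulim u])^-1).+1.
    exact: truncnS_gt.
  exists n; rewrite -[ltRHS]invrK ltf_pV2 ?posrE ?invr_gt0//.
  by rewrite (lt_trans hn)// ltr_nat.
have cl := @closed_poly_le 0 q 1 n.+1%:R^-1 ler01.
have := ulim_closed cl bu; rewrite /mkset mul1r horner0 mod0 add0r => H.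
have /H : exists n0, forall k, (n0 <= k)%N -> [set w : C | 1 * normc q.[w] <= normc 0.[w] + n.+1%:R^-1] (u k).
  exists n => k nk /=; rewrite mul1r horner0 mod0 add0r.
  have [_ /le_trans] := uP k; apply.
  by rewrite lef_pV2 ?posrE// ler_nat.
by rewrite leNgt qn.
Qed.

Lemma cheese_rational_bounded (p q : {poly C}) :
  (forall z : C, cheese z -> q.[z] != 0) ->
  exists2 M : R, 0 <= M & forall z : C, cheese z -> normc (p.[z] / q.[z]) <= M.
Proof.
move=> /cheese_poly_ge [c c0 qc]; have [M M0 pM] := mod_poly_le p 1.
exists (M / c); first by rewrite divr_ge0 ?ltW.
move=> z Xz; rewrite mod_div ler_pM ?mod_ge0 ?invr_ge0 ?mod_ge0//.
  by apply: pM; exact: Xz.1.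
by rewrite lef_pV2 ?posrE ?qc// (lt_le_trans c0)// qc.
Qed.

(** Otherwise points of the successive compact sets at which the bound fails would
    have a limit in their intersection. *)
Lemma cheese_stage (p q : {poly C}) (M : R) : 0 <= M ->
  (forall z : C, cheese z -> q.[z] != 0 /\ normc (p.[z] / q.[z]) <= M) ->
  exists A, forall w : C, normc w <= 1 ->
    (forall x : disc, x \in L A -> x.1.2 <= normc (w - x.1.1)) ->
    q.[w] != 0 /\ normc (p.[w] / q.[w]) <= M + 1.
Proof.
move=> M0 pq; apply: contrapT => nA.
have ex n : exists w : C, [/\ normc w <= 1,
    forall x : disc, x \in L n -> x.1.2 <= normc (w - x.1.1) &
    (M + 1) * normc q.[w] <= normc p.[w] + 0].
  apply: contrapT => nw; apply: nA; exists n => w w1 wL.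
  have lt : normc p.[w] < (M + 1) * normc q.[w].
    by rewrite ltNge; apply/negP => h; apply: nw; exists w; rewrite addr0.
  have q0 : 0 < normc q.[w].
    rewrite lt_def mod_ge0 andbT; apply: contraTneq lt => ->.
    by rewrite mulr0 -leNgt mod_ge0.
  split; first by rewrite -mod_gt0.
  by rewrite mod_div ler_pdivrMr// ltW.
have [u uP] := choice ex.
have [bu Xu] : bounded_seq u /\ cheese (ulim u).
  by apply: cheese_sub_limit => n; have [] := uP n.
have M1 : 0 <= M + 1 by lra.
have := ulim_closed (@closed_poly_le p q _ 0 M1) bu; rewrite /mkset.
have [q0 pM] := pq _ Xu; rewrite -mod_gt0 in q0.
move=> H; have {H} : (M + 1) * normc q.[ulim u] <= normc p.[ulim u] + 0.
  by apply: H; exists 0%N => n _; have [] := uP n.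
rewrite addr0; move: pM; rewrite mod_div ler_pdivrMr// mulrDl mul1r; lra.
Qed.

Hypothesis K_cheese : K `<=` cheese.

Definition cheese_weight n : R := eta^-1 ^+ n.+1 + W n.

Lemma RX_bounded (f : C -> C) : RX cheese f ->
  exists2 M : R, 0 <= M & forall z : C, cheese z -> normc (f z) <= M.
Proof.
move=> [_ fR]; have [p [q [q0 pqf]]] := fR 1 ltr01.
have [M M0 pqM] := cheese_rational_bounded p q0.
exists (M + 1); first lra.
move=> z Xz; have := pqf z Xz; have := pqM z Xz.
have := ler_mod_sub (f z) (p.[z] / q.[z]); lra.
Qed.

(** The functions of the algebra are smooth on [K] in the sense of Whitney: the
    derivatives of rational approximations are bounded at each point and for each
    order, and the Cauchy and Taylor estimates pass to the limit. *)
Lemma RX_smooth (f : C -> C) : RX cheese f ->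
  exists (F : nat -> C -> C) (M : R),
  [/\ 0 <= M, forall z : C, K z -> F 0%N z = f z,
      forall k (z : C), K z -> normc (F k z) <= k`!%:R * M * cheese_weight k &
      forall k (z z' : C), K z -> K z' ->
        normc (F k z' - F k z - (z' - z) * F k.+1 z) <=
        k.+2`!%:R * M * cheese_weight k.+2 * normc (z' - z) ^+ 2].
Proof.
move=> fR; have [M0 M0_ge0 fM0] := RX_bounded fR.
pose M := M0 + 2.
have ex n : exists G : nat -> C -> C,
  [/\ forall z : C, K z -> normc (G 0%N z - f z) <= n.+1%:R^-1,
      forall k (z : C), K z -> normc (G k z) <= k`!%:R * M * cheese_weight k &
      forall k (z z' : C), K z -> K z' ->
        normc (G k z' - G k z - (z' - z) * G k.+1 z) <=
        k.+2`!%:R * M * cheese_weight k.+2 * normc (z' - z) ^+ 2].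
  have n0 : 0 < n.+1%:R^-1 :> R by rewrite invr_gt0.
  have [p [q [q0 pqf]]] := fR.2 _ n0.
  have n1 : n.+1%:R^-1 <= 1 :> R by rewrite invf_le1// ler1n.
  have [||A stA] := @cheese_stage p q (M0 + 1).
  - lra.
  - move=> z Xz; split; first exact: q0.
    have h1 := pqf z Xz; have h2 := fM0 z Xz; rewrite modB in h1.
    have h3 := ler_mod_sub (p.[z] / q.[z]) (f z).
    rewrite -lerBlDl; apply: le_trans (lerB (lexx _) h2) _.
    exact: le_trans h3 (le_trans (ltW h1) n1).
  have LD (P : disc -> Prop) : (forall a x, x \in D a -> P x) ->
      forall x, x \in L A -> P x.
    by move=> H x /mem_L [a]; exact: H.
  have M2 : 0 <= M0 + 1 + 1 by lra.
  have [G [G0 G1 G2]] := @cauchy_estimates R (L A) K eta eta_gt0 eta_lt1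
    (LD _ D_gt0) (LD _ delta_gt0) (LD _ delta_le) K_in (D_small A) (D_thin A)
    p q _ M2 stA.
  have MM : M0 + 1 + 1 = M by rewrite /M -addrA.
  have wle j : disc_weight (L A) eta j.+1 <= cheese_weight j.
    by rewrite /disc_weight /cheese_weight lerD2l.
  exists G; split.
  - move=> z Kz; rewrite G0// modB ltW// pqf//; exact: K_cheese.
  - move=> k z Kz; rewrite (le_trans (G1 k z Kz))// MM ler_wpM2l//.
    by rewrite mulr_ge0// -MM.
  - move=> k z z' Kz Kz'; rewrite (le_trans (G2 k z z' Kz Kz'))// MM.
    rewrite ler_wpM2r ?exprn_ge0 ?mod_ge0// ler_wpM2l//.
    by rewrite mulr_ge0// -MM.
have [G GP] := choice ex.
have Gb k (z : C) : K z -> bounded_seq (fun n => G n k z).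
  by move=> Kz; exists (k`!%:R * M * cheese_weight k) => n; have [_ h _] := GP n; exact: h.
exists (fun k z => ulim (fun n => G n k z)), M; split.
- by rewrite /M; lra.
- move=> z Kz; apply: ulim_tends => e e0.
  exists (Num.truncn e^-1) => n ne; have [h _ _] := GP n.
  apply: le_trans (h z Kz) _; rewrite -[leRHS]invrK lef_pV2 ?posrE ?invr_gt0//.
  apply/ltW/(lt_le_trans (truncnS_gt _)).
  by rewrite ler_nat.
- move=> k z Kz; apply: ulim_le; first exact: Gb.
  by exists 0%N => n _; have [_ h _] := GP n; exact: h.
- move=> k z z' Kz Kz'.
  have -> : ulim (fun n => G n k z') - ulim (fun n => G n k z) -
      (z' - z) * ulim (fun n => G n k.+1 z) =
    ulim (fun n => G n k z' + ((-1) * G n k z + (- (z' - z)) * G n k.+1 z)).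
    rewrite !ulimD ?ulimZ//; try exact: Gb.
    + by ring.
    + exact: bounded_seqZ (Gb _ _ Kz).
    + exact: bounded_seqZ (Gb _ _ Kz).
    + by apply: bounded_seqD; apply: bounded_seqZ; exact: Gb.
  apply: ulim_le.
    apply: bounded_seqD; first exact: Gb.
    by apply: bounded_seqD; apply: bounded_seqZ; exact: Gb.
  exists 0%N => n _; have [_ _ h] := GP n.
  apply: le_trans (h k z z' Kz Kz'); rewrite le_eqVlt; apply/orP; left.
  by apply/eqP; congr normc; ring.
Qed.

End cheese.
End limits.

(** * Uniform limits of rational functions *)

Section rational_limits.
Variable R : realType.
Local Notation C := (Cplx R).

Lemma rational_continuous_at (p q : {poly C}) (x : C) (e : R) : 0 < e ->
  q.[x] != 0 ->
  exists2 d : R, 0 < d & forall w : C, normc (w - x) < d -> q.[w] != 0 ->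
    normc (p.[w] / q.[w] - p.[x] / q.[x]) < e.
Proof.
move=> e0 qx; have qx0 : 0 < normc q.[x] by rewrite mod_gt0.
pose n := p * q.[x]%:P - p.[x]%:P * q.
have n0 : n.[x] = 0 by rewrite /n !hornerE subrr.
have e1 : 0 < e * normc q.[x] ^+ 2 / 2 by rewrite divr_gt0// mulr_gt0// exprn_gt0.
have e2 : 0 < normc q.[x] / 2 by rewrite divr_gt0.
have [d1 d10 h1] := poly_continuous_at n x e1.
have [d2 d20 h2] := poly_continuous_at q x e2.
exists (Num.min d1 d2); first by rewrite lt_min d10.
move=> w; rewrite lt_min => /andP[/h1 nw /h2 qw] qw0.
rewrite n0 subr0 in nw.
have qw2 : normc q.[x] / 2 <= normc q.[w].
  by have := ler_mod_sub q.[x] q.[w]; rewrite modB; lra.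
have -> : p.[w] / q.[w] - p.[x] / q.[x] = n.[w] / (q.[w] * q.[x]).
  by rewrite /n !hornerE; field; rewrite qx qw0.
have qq0 : 0 < normc q.[w] * normc q.[x] by rewrite mulr_gt0//; lra.
rewrite mod_div modM ltr_pdivrMr//; apply: lt_le_trans nw _.
rewrite -mulrA ler_pM2l// expr2 mulrAC ler_pM2r//.
Qed.

Lemma RX_of_uniform_limit (X : set C) (f : C -> C) :
  (forall e : R, 0 < e -> exists p q : {poly C},
     (forall z : C, X z -> q.[z] != 0) /\
     forall z : C, X z -> normc (f z - p.[z] / q.[z]) < e) -> RX X f.
Proof.
move=> fa; split => //; apply/subspace_continuousP => x Xx A.
move=> /nbhs_modP [e e0 sub].
have e3 : 0 < e / 3 by rewrite divr_gt0.
have [p [q [q0 pqf]]] := fa _ e3.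
have [d d0 h] := rational_continuous_at p e3 (q0 _ Xx).
apply/nbhs_modP; exists d => // w /h wx Xw; apply: sub.
have h1 := pqf _ Xw; have h2 := pqf _ Xx; have h3 := wx (q0 _ Xw).
rewrite modB in h2; change (normc (f w - f x) < e).
have h4 := ler_mod_dist (p.[w] / q.[w]) (f w) (f x).
have h5 := ler_mod_dist (p.[x] / q.[x]) (p.[w] / q.[w]) (f x).
by lra.
Qed.

Definition rational_on (X : set C) (h : C -> C) := exists p q : {poly C},
  (forall z : C, X z -> q.[z] != 0) /\ forall z : C, X z -> h z = p.[z] / q.[z].

Lemma rational_on_prod (X : set C) (h : nat -> C -> C) :
  (forall n, rational_on X (h n)) ->
  forall n, rational_on X (fun z => \prod_(r < n) h r z).
Proof.
move=> hr; elim=> [|n [p [q [q0 pq]]]].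
  exists 1, 1; split => z _; first by rewrite hornerC oner_eq0.
  by rewrite big_ord0 hornerC divr1.
have [p' [q' [q0' pq']]] := hr n.
exists (p * p'), (q * q'); split => z Xz; rewrite !hornerM.
  by rewrite mulf_neq0 ?q0 ?q0'.
by rewrite big_ord_recr /= pq// pq'// mulf_div.
Qed.

Lemma rational_on_factor (X : set C) (c : C) (rho : R) n :
  (forall z : C, X z -> 1 - ((z - c) / (rho%:C)%C) ^+ n != 0) ->
  rational_on X (circle_factor c rho n) /\
  rational_on X (fun z => 1 - circle_factor c rho n z).
Proof.
move=> X0; have [u uE] : exists u : {poly C}, forall z : C, u.[z] = ((z - c) / (rho%:C)%C) ^+ n.
  exists ((((rho%:C)%C)^-1 *: ('X - c%:P)) ^+ n) => z.
  by rewrite horner_exp hornerZ hornerXsubC mulrC.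
have qE (z : C) : (1 - u).[z] = 1 - ((z - c) / (rho%:C)%C) ^+ n.
  by rewrite hornerD hornerN hornerC uE.
split.
  exists 1, (1 - u); split => z Xz; rewrite qE; first exact: X0.
  by rewrite hornerC div1r.
exists (- u), (1 - u); split => z Xz; rewrite qE; first exact: X0.
by have := X0 z Xz; rewrite hornerN uE /circle_factor => H; field.
Qed.

Lemma interior_subspace (X A : set C) (x : C) (e : R) : X x -> 0 < e ->
  (forall w : C, normc (w - x) < e -> X w -> A w) ->
  interior (A : set (subspace X)) x.
Proof.
move=> Xx e0 sub; have : within X (nbhs x) A by apply/nbhs_modP; exists e.
by rewrite nbhs_subspace_in.
Qed.

End rational_limits.

(** * A fine family of discs off a compact set *)

Section covering.
Variable R : realType.
Local Notation C := (Cplx R).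

Lemma compact_mod_lt1 (K : set C) : compact K -> K `<=` open_disc 0 1 ->
  exists eta : R, [/\ 0 < eta, eta < 1 & forall z : C, K z -> normc z <= 1 - 2 * eta].
Proof.
move=> cK K1; apply: contrapT => ne.
have cl : closed K by apply: compact_closed => //; exact: mod_hausdorff.
have ex n : exists z : C, K z /\ 1 - 2 / n.+2%:R <= normc z.
  apply: contrapT => nz; apply: ne; exists n.+2%:R^-1; split.
  - by rewrite invr_gt0.
  - by rewrite invf_lt1// ltr1n.
  - move=> z Kz; rewrite leNgt; apply/negP => zn; apply: nz; exists z.
    by split => //; exact: ltW.
have [u uP] := choice ex.
have bu : bounded_seq u.
  exists 1 => n; have [/K1 + _] := uP n.
  by rewrite /open_disc /= subr0 => /ltW.
have Ku : K (ulim u) by apply: ulim_closed => //; exists 0%N => n _; exact: (uP n).1.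
have : normc (ulim u) < 1 by have := K1 _ Ku; rewrite /open_disc /= subr0.
apply/negP; rewrite -leNgt.
apply/ler_addgt0Pl => e e0; rewrite -lerBlDl.
have := @ulim_closed _ [set w : C | 1 - e <= normc (w - 0)] u (@closed_mod_ge _ _ _) bu.
rewrite /mkset subr0; apply; exists (Num.truncn (2 / e)) => n ne'.
rewrite subr0; apply: le_trans (uP n).2; rewrite lerD2l lerN2.
rewrite ler_pdivrMr// mulrC -ler_pdivrMr//.
apply/ltW/(lt_le_trans (truncnS_gt _)).
by rewrite ler_nat ltnS (leq_trans ne').
Qed.

(** The centres are points of the grids of mesh 1 / n, with radius 8 / n, those which
    are too close to [K] being replaced with a fixed disc outside the unit disc. *)
Lemma disc_family (K : set C) : closed K -> K `<=` open_disc 0 1 ->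
  exists (cen : int * int * nat -> C) (sc : int * int * nat -> R),
  [/\ forall i, 0 < sc i,
      forall i (z : C), K z -> 2 * sc i <= normc (cen i - z) &
      forall (x : C) (t : R), ~ K x -> 0 < t ->
        exists i, normc (x - cen i) <= sc i / 4 /\ sc i < t].
Proof.
move=> clK K1.
pose c0 (i : int * int * nat) : C := (i.1.1%:~R / i.2.+1%:R +i* (i.1.2%:~R / i.2.+1%:R))%C.
pose s0 (i : int * int * nat) : R := 8 / i.2.+1%:R.
pose ok i := forall z : C, K z -> 2 * s0 i <= normc (c0 i - z).
exists (fun i => if pselect (ok i) then c0 i else 10%:R).
exists (fun i => if pselect (ok i) then s0 i else 1); split.
- by move=> i; case: pselect => a /=; rewrite ?divr_gt0.
- move=> i z Kz; case: pselect => a /=; first exact: a.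
  have := K1 _ Kz; rewrite /open_disc /= subr0 => z1.
  by have := ler_mod_sub 10%:R z; rewrite mod_nat; lra.
move=> x t nKx t0.
have [e e0 nK] : exists2 e : R, 0 < e & forall w : C, normc (w - x) < e -> ~ K w.
  apply/nbhs_modP; apply: open_nbhs_nbhs; split => //.
  exact: closed_openC clK.
pose N := Num.truncn (Num.max (8 / t) (18 / e)).
have N1 : Num.max (8 / t) (18 / e) < N.+1%:R by exact: truncnS_gt.
move: N1; rewrite gt_max => /andP[Nt Ne].
have N0 : 0 < N.+1%:R :> R by [].
pose n := N.+1%:R : R.
pose i : int * int * nat := (Num.floor (complex.Re x * n), Num.floor (complex.Im x * n), N).
have near (y : R) : `|y - (Num.floor (y * n))%:~R / n| <= n^-1.
  have h1 := Num.Theory.floor_le (y * n); have h2 := floorD1_gt (y * n).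
  have -> : y - (Num.floor (y * n))%:~R / n = (y * n - (Num.floor (y * n))%:~R) / n.
    by rewrite mulrBl mulfK// gt_eqF.
  rewrite normrM normfV (gtr0_norm N0) ler_piMl ?invr_ge0 ?ltW// .
  rewrite ltr_norml; move: h2; rewrite intrD => h2; lra.
have xc : normc (x - c0 i) <= 2 / n.
  have -> : x - c0 i = ((complex.Re x - (Num.floor (complex.Re x * n))%:~R / n)
    +i* (complex.Im x - (Num.floor (complex.Im x * n))%:~R / n))%C.
    have xE : x = (complex.Re x +i* complex.Im x)%C by case: (x).
    by rewrite {1}xE.
  apply: le_trans (mod_ReIm_le _ _) _.
  by apply: le_trans (lerD (near _) (near _)) _; rewrite -mulr2n mulr_natl.
have oki : ok i.
  move=> z Kz; rewrite leNgt; apply/negP => lt.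
  apply: (nK z _ Kz); rewrite modB.
  have h : 18 / n < e by rewrite ltr_pdivrMr// mulrC -ltr_pdivrMr.
  have s0E : s0 i = 8 * n^-1 by [].
  rewrite s0E in lt; have tri := ler_mod_dist (c0 i) x z.
  by move: (n^-1) xc h lt tri => v; lra.
exists i; case: pselect => // a /=; split.
  apply: le_trans xc _; have -> : s0 i = 8 * n^-1 by [].
  by move: (n^-1) => v; lra.
by rewrite /s0 /= ltr_pdivrMr// mulrC -ltr_pdivrMr.
Qed.

End covering.

(** * Harmonic sums and the divergence of the series *)

Section harmonic_sums.
Variable R : realType.

Definition harmonic_sum n : R := \sum_(i < n) i.+1%:R^-1.

Lemma harmonic_sum_ge0 n : 0 <= harmonic_sum n.
Proof. by apply: sumr_ge0 => i _; rewrite invr_ge0. Qed.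

Lemma harmonic_sum_mono m n : (m <= n)%N -> harmonic_sum m <= harmonic_sum n.
Proof.
move=> /subnKC <-; elim: (n - m)%N => [|k IH]; first by rewrite addn0.
by rewrite addnS {2}/harmonic_sum big_ord_recr /= (le_trans IH)// lerDl invr_ge0.
Qed.

Lemma harmonic_sum_gt0 n : 0 < harmonic_sum n.+1.
Proof.
rewrite /harmonic_sum big_ord_recl ltr_pwDl ?invr_gt0//.
by apply: sumr_ge0 => i _; rewrite invr_ge0.
Qed.

Lemma harmonic_sum_unbounded (M : R) : exists n, M <= harmonic_sum n.
Proof.
apply: contrapT => nM; apply: (@dvg_harmonic R).
have hE n : series (@harmonic R) n = harmonic_sum n.
  by rewrite /series /= big_mkord.
apply: nondecreasing_is_cvgn.
  by move=> m n mn; rewrite !hE; exact: harmonic_sum_mono.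
exists M => _ [n _ <-]; rewrite hE leNgt; apply/negP => /ltW h.
by apply: nM; exists n.
Qed.

Lemma harmonic_sum_expn_gt0 n : 0 < harmonic_sum n ^+ n.
Proof. by case: n => [|n]; rewrite ?expr0// exprn_gt0// harmonic_sum_gt0. Qed.

(** Harmonic sums are eventually larger than [q]; the constant [M] takes care of the
    finitely many other terms. *)
Lemma geometric_le_harmonic (q : R) : 0 < q -> exists2 M : R, 0 < M &
  forall n, q ^+ n.+1 <= M * harmonic_sum n ^+ n.
Proof.
move=> q0; have [k kq] := harmonic_sum_unbounded q.
pose a n := q ^+ n.+1 / harmonic_sum n ^+ n.
have a0 n : 0 < a n.
  exact: divr_gt0 (exprn_gt0 _ q0) (harmonic_sum_expn_gt0 n).
have s0 (m : nat) : 0 <= \sum_(n < m) a n by apply: sumr_ge0 => n _; exact: ltW.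
exists (q + \sum_(n < k) a n); first by rewrite ltr_pwDl.
move=> n; have hn := harmonic_sum_expn_gt0 n.
have [kn|nk] := leqP k n.
  apply: (@le_trans _ _ (q * harmonic_sum n ^+ n)); last first.
    by rewrite ler_pM2r// lerDl.
  rewrite exprS ler_pM2l// lerXn2r ?nnegrE ?(ltW q0) ?harmonic_sum_ge0//.
  exact: le_trans kq (harmonic_sum_mono kn).
have -> : q ^+ n.+1 = a n * harmonic_sum n ^+ n by rewrite /a divfK// gt_eqF.
rewrite ler_pM2r// (bigD1 (Ordinal nk))//= addrCA lerDl addr_ge0 ?(ltW q0)//.
by apply: sumr_ge0 => i _; exact: ltW.
Qed.

(** The argument of Abel and Dini: between m and n, the terms 1 / (k H_k) have a sum
    of at least (H_n - H_m) / H_n, which is at least 1 / 2 for large n. *)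
Lemma abel_dini (B : R) :
  exists n, B <= \sum_(k < n) (k.+1%:R * harmonic_sum k.+1)^-1.
Proof.
pose S n := \sum_(k < n) (k.+1%:R * harmonic_sum k.+1)^-1.
have step m : exists n, S m + 2^-1 <= S n.
  have [n0 hn0] := harmonic_sum_unbounded (2 * harmonic_sum m.+1).
  pose n := (maxn m.+1 n0).
  have mn : (m.+1 <= n)%N by exact: leq_maxl.
  have hn : 2 * harmonic_sum m.+1 <= harmonic_sum n.
    by rewrite (le_trans hn0)// harmonic_sum_mono// leq_maxr.
  have n0' : 0 < harmonic_sum n.
    by apply: lt_le_trans (harmonic_sum_gt0 m) (harmonic_sum_mono mn).
  exists n; have diff j : (m <= j <= n)%N ->
      (harmonic_sum j - harmonic_sum m) / harmonic_sum n <= S j - S m.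
    elim: j => [|j IH].
      by rewrite leqn0 => /andP[/eqP -> _]; rewrite !subrr mul0r.
    rewrite leq_eqVlt => /andP[/orP[/eqP <- _|mj jn]].
      by rewrite !subrr mul0r.
    have := IH; rewrite -ltnS mj (ltnW jn) => /(_ isT) h.
    have tm : j.+1%:R^-1 / harmonic_sum n <= (j.+1%:R * harmonic_sum j.+1)^-1.
      rewrite invfM ler_pM2l ?invr_gt0// lef_pV2 ?posrE ?harmonic_sum_gt0//.
      exact: harmonic_sum_mono.
    have -> : harmonic_sum j.+1 = harmonic_sum j + j.+1%:R^-1.
      by rewrite /harmonic_sum big_ord_recr.
    have -> : S j.+1 = S j + (j.+1%:R * harmonic_sum j.+1)^-1.
      by rewrite /S big_ord_recr.
    rewrite addrAC mulrDl [leRHS]addrAC lerD//.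
  have mn' : (m <= n <= n)%N by rewrite leqnn ltnW.
  have := diff n mn'; suff : 2^-1 <= (harmonic_sum n - harmonic_sum m) / harmonic_sum n.
    lra.
  rewrite ler_pdivlMr//; have := harmonic_sum_mono (leqnSn m); lra.
have many j : exists n, j%:R / 2 <= S n.
  elim: j => [|j [n hn]]; first by exists 0%N; rewrite /S big_ord0 mul0r.
  have [n' hn'] := step n; exists n'; rewrite -natr1 mulrDl; lra.
have [n hn] := many (Num.truncn (2 * B)).+1; exists n.
have := truncnS_gt (2 * B); move: hn; rewrite /S; lra.
Qed.

Lemma fact_le_expn k : (k`! <= k ^ k)%N.
Proof.
suff h m : (m <= k)%N -> (m`! <= k ^ m)%N by exact: h.
elim: m => // m IH mk; rewrite factS expnS leq_mul// IH//.
exact: ltnW.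
Qed.

(** As k! <= k ^ k and A >= 1, the k-th root of A k! H_k ^ k is at most A k H_k. *)
Lemma denjoy_carleman_sum (s : nat -> \bar R) (A : R) : 1 <= A ->
  (forall k, (0 <= s k)%E) ->
  (forall k, (s k <= (A * k`!%:R * harmonic_sum k ^+ k)%:E)%E) ->
  (\sum_(1 <= k <oo) 1 / (s k `^ (k%:R^-1)) = +oo)%E.
Proof.
move=> A1 s0 sA; have A0 : 0 < A by lra.
have t_ge k : (((A * (k.+1%:R * harmonic_sum k.+1))^-1)%:E <=
               1 / (s k.+1 `^ (k.+1%:R^-1)))%E.
  have := sA k.+1; have := s0 k.+1; case: (s k.+1) => [r| |]//.
  rewrite !lee_fin poweR_EFin => r0 rA.
  pose b := A * (k.+1%:R * harmonic_sum k.+1).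
  have b0 : 0 < b by rewrite !mulr_gt0// harmonic_sum_gt0.
  have rb : r `^ k.+1%:R^-1 <= b.
    have -> : b = (b ^+ k.+1) `^ k.+1%:R^-1.
      by rewrite -powR_mulrn ?(ltW b0)// -powRrM mulfV// powRr1// ltW.
    apply: ge0_ler_powR; rewrite ?nnegrE ?invr_ge0 ?exprn_ge0 ?(ltW b0)//.
    apply: le_trans rA _; rewrite /b !exprMn mulrA ler_pM2r; last first.
      by rewrite exprn_gt0// harmonic_sum_gt0.
    rewrite ler_pM ?(ltW A0)//; first by rewrite exprS ler_peMr ?(ltW A0)// exprn_ege1.
    by rewrite -natrX ler_nat fact_le_expn.
  have [r00|r00] := eqVneq (r `^ k.+1%:R^-1) 0.
    by rewrite r00 inver eqxx mul1e leey.
  rewrite inver (negbTE r00) mul1e lee_fin lef_pV2 ?posrE//.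
  by rewrite lt_def r00 powR_ge0.
have t0 k : (1 <= k)%N -> (0 <= 1 / (s k `^ (k%:R^-1)))%E.
  case: k => // k _; apply: le_trans (t_ge k).
  by rewrite lee_fin invr_ge0 !mulr_ge0 ?(ltW A0)// harmonic_sum_ge0.
apply/eqyP => B B0; have [n hn] := abel_dini (A * B).
apply: le_trans (nneseries_lim_ge n.+1 _); last by move=> k k1 _; exact: t0.
rewrite big_add1 /= big_mkord.
apply: (@le_trans _ _ (\sum_(k < n) ((A * (k.+1%:R * harmonic_sum k.+1))^-1)%:E)%E).
  rewrite sumEFin lee_fin; under eq_bigr do rewrite invfM.
  by rewrite -mulr_sumr mulrC ler_pdivlMr// mulrC.
by apply: lee_sum => k _; exact: t_ge.
Qed.

End harmonic_sums.

(** * Derivatives along segments *)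

Section segments.
Variable R : realType.
Local Notation C := (Cplx R).

Lemma segment_limit_point (a b z : C) (e : R) : a != b -> closed_segment a b z ->
  0 < e -> exists w : C, [/\ closed_segment a b w, w != z & normc (w - z) < e].
Proof.
move=> ab [t + <-] e0; rewrite /= in_itv /= => /andP[t0 t1].
have ba : 0 < normc (b - a) by rewrite mod_gt0 subr_eq0 eq_sym.
pose s := Num.min (2^-1) (e / 2 / normc (b - a)).
have s0 : 0 < s by rewrite lt_min invr_gt0 ltr0n /= !divr_gt0.
have s1 : s <= 2^-1 by rewrite ge_min lexx.
have se : s * normc (b - a) <= e / 2.
  by rewrite -ler_pdivlMr// ge_min lexx orbT.
have go (d : R) : 0 <= t + d <= 1 -> `|d| = s ->
  exists w : C, [/\ closed_segment a b w,
    w != ((1 - t)%:C)%C * a + (t%:C)%C * b &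
    normc (w - (((1 - t)%:C)%C * a + (t%:C)%C * b)) < e].
  move=> td ds; exists (((1 - (t + d))%:C)%C * a + ((t + d)%:C)%C * b).
  have dE : ((1 - (t + d))%:C)%C * a + ((t + d)%:C)%C * b -
      (((1 - t)%:C)%C * a + (t%:C)%C * b) = (d%:C)%C * (b - a) :> C.
    by rewrite !rmorphB !rmorphD rmorph1 /=; ring.
  have dn : normc ((d%:C)%C * (b - a) : C) = s * normc (b - a).
    by rewrite modM mod_real ds.
  split.
  - by exists (t + d) => //; rewrite /= in_itv.
  - by rewrite -subr_eq0 dE -mod_gt0 dn mulr_gt0.
  - by rewrite dE dn; lra.
have [t2|t2] := leP t 2^-1.
  by apply: (go s); [apply/andP; split; lra|exact: gtr0_norm].
by apply: (go (- s)); [apply/andP; split; lra|rewrite normrN gtr0_norm].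
Qed.

Lemma within_dnbhsP (I A : set C) (z : C) : within I z^' A <->
  exists2 e : R, 0 < e &
    forall w : C, normc (w - z) < e -> w != z -> I w -> A w.
Proof.
split.
  by move=> /nbhs_modP [e e0 h]; exists e.
by move=> [e e0 h]; apply/nbhs_modP; exists e => // w we wz Iw; exact: h.
Qed.

Lemma segment_proper (a b z : C) : a != b -> closed_segment a b z ->
  ProperFilter (within (closed_segment a b) z^').
Proof.
move=> ab Iz; split; last exact: within_filter.
move=> /within_dnbhsP [e e0 h].
by have [w [Iw wz we]] := segment_limit_point ab Iz e0; exact: h we wz Iw.
Qed.

Section taylor.
Variables (a b : C) (F : nat -> C -> C) (c : nat -> R).
Hypothesis ab : a != b.
Let I := closed_segment a b.
Hypothesis F_taylor : forall k (z w : C), I z -> I w ->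
  normc (F k w - F k z - (w - z) * F k.+1 z) <= c k * normc (w - z) ^+ 2.

Lemma segment_quotient_cvg k (g : C -> C) (z : C) :
  (forall w : C, I w -> g w = F k w) -> I z ->
  segment_quotient I g z --> F k.+1 z.
Proof.
move=> gF Iz A /nbhs_modP [e e0 sub].
have c0 : 0 < `|c k| + 1 by rewrite ltr_wpDl.
apply/within_dnbhsP; exists (e / (`|c k| + 1)); first by rewrite divr_gt0.
move=> w; rewrite ltr_pdivlMr// => we wz Iw; apply: sub.
have wz0 : w - z != 0 by rewrite subr_eq0.
have nwz : 0 < normc (w - z) by rewrite mod_gt0.
have -> : (g w - g z) / (w - z) - F k.+1 z =
    (F k w - F k z - (w - z) * F k.+1 z) / (w - z).
  by rewrite !gF//; field.
rewrite mod_div ltr_pdivrMr//; apply: le_lt_trans (F_taylor k Iz Iw) _.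
rewrite expr2 mulrA ltr_pM2r//.
apply: le_lt_trans we; rewrite mulrC ler_wpM2l ?mod_ge0//.
by rewrite (le_trans (ler_norm _))// lerDl.
Qed.

Lemma segment_derivnE k (z : C) : I z -> segment_derivn I k (F 0%N) z = F k z.
Proof.
elim: k z => [//|k IH] z Iz; rewrite /segment_derivn iterS -/(segment_derivn I k (F 0%N)).
have FF := segment_proper ab Iz.
exact: (cvg_lim (@mod_hausdorff R) (segment_quotient_cvg IH Iz)).
Qed.

End taylor.

Lemma eq_segment_derivn (I : set C) (f g : C -> C) k :
  (forall z : C, I z -> f z = g z) ->
  forall z : C, I z -> segment_derivn I k f z = segment_derivn I k g z.
Proof.
move=> fg; elim: k => [//|k IH] z Iz; rewrite /segment_derivn !iterS.
rewrite -/(segment_derivn I k f) -/(segment_derivn I k g) /segment_deriv.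
congr (lim _); apply/seteqP; split => A /within_dnbhsP [e e0 h];
  apply/within_dnbhsP; exists e => // w we wz Iw; have := h w we wz Iw;
  by rewrite /preimage /mkset !IH.
Qed.

(** The Taylor estimates say that [F k.+1] is the derivative of [F k] along the
    segment. *)
Lemma smooth_on_segment (a b : C) (f : C -> C) (F : nat -> C -> C) (c : nat -> R) :
  a != b -> let I := closed_segment a b in
  (forall z : C, I z -> F 0%N z = f z) ->
  (forall k (z w : C), I z -> I w ->
    normc (F k w - F k z - (w - z) * F k.+1 z) <= c k * normc (w - z) ^+ 2) ->
  infinitely_differentiable_on I f /\
  forall k (z : C), I z -> segment_derivn I k f z = F k z.
Proof.
move=> ab I F0 FT.
have dE k (z : C) : I z -> segment_derivn I k f z = F k z.
  move=> Iz; rewrite -(segment_derivnE ab FT k Iz).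
  by apply: eq_segment_derivn => // w Iw; rewrite F0.
split => // k z Iz; apply/cvg_ex; exists (F k.+1 z).
by apply: (segment_quotient_cvg FT) => // w; exact: dE.
Qed.

End segments.

(** * The Swiss cheese *)

Section construction.
Variable R : realType.
Local Notation C := (Cplx R).
Local Notation disc := (C * R * R)%type.

Lemma unity_roots m : exists2 rs : seq C, size rs = (2 ^ m)%N &
  forall y, (y \in rs) = (y ^+ (2 ^ m) == 1).
Proof.
have n0 : (0 < 2 ^ m)%N by rewrite expn_gt0.
have [rs prs] := closed_field_poly_normal ('X^(2 ^ m) - 1 : {poly C}).
rewrite (monicP _) ?monicXnsubC// scale1r in prs; exists rs.
  by apply: succn_inj; rewrite -(size_prod_XsubC rs id) -prs size_XnsubC.
by move=> y; rewrite -root_prod_XsubC -prs /root !hornerE subr_eq0.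
Qed.

Local Notation J := (int * int * nat)%type.
Variables (K : set C) (eta : R) (cen : J -> C) (sc : J -> R).
Hypothesis eta_gt0 : 0 < eta.
Hypothesis eta_lt1 : eta < 1.
Hypothesis K_neq0 : K !=set0.
Hypothesis K_in : forall z : C, K z -> normc z <= 1 - 2 * eta.
Hypothesis sc_gt0 : forall i, 0 < sc i.
Hypothesis K_far : forall i (z : C), K z -> 2 * sc i <= normc (cen i - z).
Hypothesis fine : forall (x : C) (t : R), ~ K x -> 0 < t ->
  exists i, normc (x - cen i) <= sc i / 4 /\ sc i < t.

(** The index of a circle consists of a disc of the family, of a boolean which tells
    whether the circles increase to the boundary of this disc or decrease to the
    circle of half its radius, and of its rank among them. *)
Local Notation idx := (J * bool * nat)%type.

Definition circle_of (a : nat) : idx := odflt ((0, 0, 0%N), true, 0%N) (unpickle a).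

Lemma circle_ofK (i : idx) : circle_of (pickle i) = i.
Proof. by rewrite /circle_of pickleK. Qed.

Definition half_pow n : R := 2^-1 ^+ n.

Lemma half_pow_gt0 n : 0 < half_pow n.
Proof. by rewrite exprn_gt0. Qed.

Lemma half_pow_le1 n : half_pow n <= 1.
Proof. by rewrite exprn_ile1//; lra. Qed.

Lemma half_powS n : half_pow n.+1 = half_pow n / 2.
Proof. by rewrite /half_pow exprSr. Qed.

(** The circle lies between the inner and the outer radii, and the outer radius of
    a circle is the inner radius of the next one, or the converse if the circles
    decrease: a point is strictly inside at most one of these annuli. *)
Definition radius (i : idx) : R :=
  if i.1.2 then sc i.1.1 * (1 - half_pow i.2 / 2)
  else sc i.1.1 * (1 / 2 + half_pow i.2 / 4).

Definition inner_radius (i : idx) : R :=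
  if i.1.2 then sc i.1.1 * (1 - 3 * half_pow i.2 / 4)
  else sc i.1.1 * (1 / 2 + 3 * half_pow i.2 / 16).

Definition outer_radius (i : idx) : R :=
  if i.1.2 then sc i.1.1 * (1 - 3 * half_pow i.2 / 8)
  else sc i.1.1 * (1 / 2 + 3 * half_pow i.2 / 8).

Lemma radii (i : idx) : [/\ 0 < inner_radius i, inner_radius i < radius i,
  radius i < outer_radius i & radius i <= sc i.1.1].
Proof.
have s0 := sc_gt0 i.1.1; have x0 := half_pow_gt0 i.2; have x1 := half_pow_le1 i.2.
rewrite /inner_radius /radius /outer_radius; case: ifP => _; split;
  rewrite ?mulr_gt0 ?ltr_pM2l//; try lra.
  by rewrite ler_piMr ?(ltW s0)//; lra.
by rewrite ler_piMr ?(ltW s0)//; lra.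
Qed.

Lemma radius_gt0 i : 0 < radius i.
Proof. by have [h1 h2 _ _] := radii i; exact: lt_trans h2. Qed.

(** The total radius of the discs on a circle is the radius of the circle times its
    thickness.  The conditions make the sums over all the circles of the radii,
    of the ratios radius / distance and of the Cauchy weights small enough. *)
Lemma thickness_exists a : exists k : R, [/\ 0 < k, k <= 1,
  k <= half_pow a.+3,
  sc (circle_of a).1.1 * k <= half_pow a.+3 * eta &
  forall n, sc (circle_of a).1.1 * k * (2 / sc (circle_of a).1.1) ^+ n.+1 <=
    half_pow a.+1 * harmonic_sum R n ^+ n].
Proof.
set s := sc _; have s0 : 0 < s by exact: sc_gt0.
have q0 : 0 < 2 / s by rewrite divr_gt0.
have [M M0 hM] := geometric_le_harmonic q0.
pose t := Num.min 1 (Num.min (eta / s) (s * M)^-1).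
have t0 : 0 < t by rewrite !lt_min ltr01 divr_gt0//= invr_gt0 mulr_gt0.
have t1 : t <= 1 by rewrite ge_min lexx.
have t2 : s * t <= eta by rewrite mulrC -ler_pdivlMr// !ge_min lexx /= orbT.
have t3 : s * t * M <= 1.
  by rewrite mulrAC mulrC -ler_pdivlMr ?mulr_gt0// div1r !ge_min lexx /= !orbT.
have h0 := half_pow_gt0 a.+3; have h1 := half_pow_le1 a.+3.
exists (half_pow a.+3 * t); split.
- by rewrite mulr_gt0.
- by rewrite mulr_ile1// ltW.
- by rewrite ler_piMr// ltW.
- by rewrite mulrCA ler_pM2l.
- move=> n; have hn := harmonic_sum_expn_gt0 R n.
  apply: (@le_trans _ _ (half_pow a.+3 * (s * t * M) * harmonic_sum R n ^+ n)).
    have -> : half_pow a.+3 * (s * t * M) * harmonic_sum R n ^+ n =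
      s * (half_pow a.+3 * t) * (M * harmonic_sum R n ^+ n) by ring.
    by rewrite ler_pM2l ?hM//; exact: mulr_gt0 s0 (mulr_gt0 h0 t0).
  rewrite ler_pM2r//; apply: (@le_trans _ _ (half_pow a.+3)).
    by rewrite ler_piMr// ltW.
  by rewrite !half_powS; have := half_pow_gt0 a; lra.
Qed.

Definition thickness (a : nat) : R := sval (cid (thickness_exists a)).

Lemma thicknessP a : [/\ 0 < thickness a, thickness a <= 1,
  thickness a <= half_pow a.+3,
  sc (circle_of a).1.1 * thickness a <= half_pow a.+3 * eta &
  forall n, sc (circle_of a).1.1 * thickness a * (2 / sc (circle_of a).1.1) ^+ n.+1 <=
    half_pow a.+1 * harmonic_sum R n ^+ n].
Proof. by rewrite /thickness; case: cid. Qed.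

Definition factor_bound (j : J * bool) (r : nat) : R :=
  2 / thickness (pickle (j, r)) + 1.

Lemma factor_bound_ge0 j r : 0 <= factor_bound j r.
Proof.
have [k0 _ _ _ _] := thicknessP (pickle (j, r)).
by rewrite addr_ge0// divr_ge0// ltW.
Qed.

Lemma error_budget_gt0 (B : nat -> R) n : (forall r, 0 <= B r) -> 0 < error_budget B n.
Proof.
move=> B0; rewrite /error_budget divr_gt0 ?exprn_gt0//.
by apply: prodr_gt0 => r _; rewrite ltr_wpDl.
Qed.

(** The budget depends on the thicknesses and on no exponent. *)
Lemma exponent_exists a : exists m, forall z : C,
  let i := circle_of a in
  let e := error_budget (factor_bound i.1) i.2 in
  (normc (z - cen i.1.1) <= inner_radius i ->
     normc (circle_factor (cen i.1.1) (radius i) (2 ^ m) z - 1) <= e) /\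
  (outer_radius i <= normc (z - cen i.1.1) ->
     normc (circle_factor (cen i.1.1) (radius i) (2 ^ m) z) <= e).
Proof.
have [h1 h2 h3 _] := radii (circle_of a).
have e0 := error_budget_gt0 (circle_of a).2 (factor_bound_ge0 (circle_of a).1).
have [m hm] := circle_factor_approx h1 h2 h3 e0.
by exists m => z i e; exact: hm.
Qed.

Definition exponent (a : nat) : nat := sval (cid (exponent_exists a)).

Lemma exponentP a i (z : C) : circle_of a = i ->
  (normc (z - cen i.1.1) <= inner_radius i ->
     normc (circle_factor (cen i.1.1) (radius i) (2 ^ exponent a) z - 1) <=
     error_budget (factor_bound i.1) i.2) /\
  (outer_radius i <= normc (z - cen i.1.1) ->
     normc (circle_factor (cen i.1.1) (radius i) (2 ^ exponent a) z) <=
     error_budget (factor_bound i.1) i.2).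
Proof. by move=> <-; exact: (svalP (cid (exponent_exists a)) z). Qed.

Definition roots_seq (m : nat) : seq C := s2val (cid2 (unity_roots m)).

Lemma size_roots_seq m : size (roots_seq m) = (2 ^ m)%N.
Proof. by rewrite /roots_seq; case: cid2. Qed.

Lemma mem_roots_seq m y : (y \in roots_seq m) = (y ^+ (2 ^ m) == 1).
Proof. by rewrite /roots_seq; case: cid2. Qed.

Definition disc_centre (a : nat) (y : C) : C :=
  cen (circle_of a).1.1 + ((radius (circle_of a))%:C)%C * y.

Definition disc_radius (a : nat) : R :=
  radius (circle_of a) * thickness a / (2 ^ exponent a)%:R.

(** The discs on the circle of index [a], around the poles of its factor. *)
Definition block (a : nat) : seq disc :=
  [seq (disc_centre a y, disc_radius a, sc (circle_of a).1.1) |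
     y <- roots_seq (exponent a)].

Lemma disc_radius_gt0 a : 0 < disc_radius a.
Proof.
have [k0 _ _ _ _] := thicknessP a.
by rewrite divr_gt0 ?mulr_gt0 ?radius_gt0// ltr0n expn_gt0.
Qed.

Lemma block_sum a (psi : R -> R) : \sum_(x <- block a) x.1.2 * psi x.2 =
  radius (circle_of a) * thickness a * psi (sc (circle_of a).1.1).
Proof.
rewrite big_map /= big_const_seq count_predT size_roots_seq iter_addr_0.
by rewrite -mulr_natr /disc_radius mulrAC divfK// pnatr_eq0 -lt0n expn_gt0.
Qed.

Lemma family_sum (psi : R -> R) (B : R) A : 0 <= B ->
  (forall a, radius (circle_of a) * thickness a * psi (sc (circle_of a).1.1) <=
    half_pow a.+1 * B) ->
  \sum_(x <- flatten [seq block a | a <- iota 0 A]) x.1.2 * psi x.2 <= B.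
Proof.
move=> B0 h; rewrite big_flatten big_map /=.
apply: (@le_trans _ _ ((1 - half_pow A) * B)); last first.
  by rewrite ler_piMl//; have := half_pow_gt0 A; lra.
elim: A => [|A IH]; first by rewrite big_nil /half_pow expr0 subrr mul0r.
rewrite -[A.+1]addn1 iotaD big_cat /= big_seq1 add0n addn1.
apply: le_trans (lerD IH (_ : _ <= half_pow A.+1 * B)) _.
  by rewrite block_sum.
by rewrite -mulrDl half_powS ler_wpM2r//; lra.
Qed.

Lemma radius_thickness a : radius (circle_of a) * thickness a <=
  sc (circle_of a).1.1 * thickness a.
Proof.
have [k0 _ _ _ _] := thicknessP a; have [_ _ _ h] := radii (circle_of a).
by rewrite ler_pM2r.
Qed.

Lemma family_small A :
  \sum_(x <- flatten [seq block a | a <- iota 0 A]) x.1.2 < eta / 2.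
Proof.
apply: (@le_lt_trans _ _ (eta / 4)); last by have := eta_gt0; lra.
under eq_bigr => x _ do rewrite -[x.1.2]mulr1.
apply: (@family_sum (fun=> 1)); first by rewrite divr_ge0// ltW.
move=> a; rewrite mulr1; apply: le_trans (radius_thickness a) _.
have [_ _ _ h _] := thicknessP a; apply: le_trans h _.
by rewrite !half_powS; have := half_pow_gt0 a; have := eta_gt0; nra.
Qed.

Lemma family_thin A :
  \sum_(x <- flatten [seq block a | a <- iota 0 A]) x.1.2 / x.2 <= 4^-1.
Proof.
apply: (@family_sum (fun d => d^-1)) => // a.
have s0 := sc_gt0 (circle_of a).1.1.
rewrite ler_pdivrMr//; apply: le_trans (radius_thickness a) _.
rewrite mulrC ler_pM2r//; have [_ _ h _ _] := thicknessP a.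
by apply: le_trans h _; rewrite !half_powS; have := half_pow_gt0 a; lra.
Qed.

Lemma family_weight A n :
  \sum_(x <- flatten [seq block a | a <- iota 0 A]) x.1.2 * (2 / x.2) ^+ n.+1 <=
  harmonic_sum R n ^+ n.
Proof.
apply: (@family_sum (fun d => (2 / d) ^+ n.+1)).
  exact/ltW/harmonic_sum_expn_gt0.
move=> a; have [_ _ _ _ /(_ n) h] := thicknessP a; apply: le_trans h.
have s0 := sc_gt0 (circle_of a).1.1.
rewrite ler_wpM2r ?radius_thickness//.
by apply: exprn_ge0; rewrite divr_ge0// ltW.
Qed.

Lemma block_gt0 a (x : disc) : x \in block a -> 0 < x.1.2.
Proof. by move=> /mapP[y _ ->]; exact: disc_radius_gt0. Qed.

Lemma block_delta_gt0 a (x : disc) : x \in block a -> 0 < x.2.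
Proof. by move=> /mapP[y _ ->]; exact: sc_gt0. Qed.

Lemma block_far a (x : disc) : x \in block a ->
  forall z : C, K z -> x.2 <= normc (x.1.1 - z).
Proof.
move=> /mapP[y yr ->] z Kz /=; set i := circle_of a.
have y1 : normc y = 1.
  move: yr; rewrite mem_roots_seq => /eqP; apply: mod_unity_root.
  by rewrite expn_gt0.
have far := K_far i.1.1 Kz; have [_ _ _ rs] := radii i.
have r0 := radius_gt0 i.
have ry : normc (((radius i)%:C)%C * y) = radius i.
  by rewrite modM mod_real_ge0 ?(ltW r0)// y1 mulr1.
have -> : disc_centre a y - z = (cen i.1.1 - z) - (- (((radius i)%:C)%C * y)).
  by rewrite /disc_centre -/i; ring.
have := ler_mod_sub (cen i.1.1 - z) (- (((radius i)%:C)%C * y)).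
by rewrite modN ry; lra.
Qed.

Definition X_cheese : set C := cheese block.

Lemma K_sub_cheese : K `<=` X_cheese.
Proof.
move=> z Kz; split; first by have := K_in Kz; have := eta_gt0; lra.
move=> a x xa; rewrite modB; apply: le_trans (block_far xa Kz).
move: xa => /mapP[y _ ->] /=; rewrite /disc_radius.
have [k0 k1 _ _ _] := thicknessP a; have [_ _ _ rs] := radii (circle_of a).
have r0 := radius_gt0 (circle_of a).
rewrite ler_pdivrMr ?ltr0n ?expn_gt0//.
apply: (@le_trans _ _ (sc (circle_of a).1.1 * 1)).
  by rewrite ler_pM// ?ltW.
by rewrite ler_pM2l// ler1n expn_gt0.
Qed.

Lemma X_swiss_cheese : swiss_cheese_set X_cheese.
Proof.
split.
  split; first by have [z /K_sub_cheese Xz] := K_neq0; exists z.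
  exact: compact_cheese.
pose ij n : nat * nat := odflt (0%N, 0%N) (unpickle n).
exists 0, 1, (fun n => disc_centre (ij n).1 (nth 1 (roots_seq (exponent (ij n).1)) (ij n).2)),
  (fun n => disc_radius (ij n).1); split => //.
  by move=> n; exact: disc_radius_gt0.
have root_nth a j : nth 1 (roots_seq (exponent a)) j \in roots_seq (exponent a).
  have [ja|ja] := ltnP j (size (roots_seq (exponent a))); first exact: mem_nth.
  by rewrite nth_default// mem_roots_seq expr1n.
apply/seteqP; split => [w [w1 wD]|w [w1 wD]].
  split; first by rewrite /closed_disc /= subr0.
  move=> [n _]; apply/negP; rewrite -leNgt.
  set a := (ij n).1; set y := nth _ _ _.
  apply: (wD a (disc_centre a y, disc_radius a, sc (circle_of a).1.1)).
  by apply/mapP; exists y => //; exact: root_nth.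
split; first by move: w1; rewrite /closed_disc /= subr0.
move=> a x /mapP[y yr ->] /=; rewrite leNgt; apply/negP => wy; apply: wD.
exists (pickle (a, index y (roots_seq (exponent a)))) => //.
by rewrite /open_disc /mkset /ij pickleK /= nth_index.
Qed.

Lemma X_disc_far a i (z y : C) : circle_of a = i -> X_cheese z ->
  y ^+ (2 ^ exponent a) = 1 ->
  radius i * thickness a / (2 ^ exponent a)%:R <=
    normc (z - (cen i.1.1 + ((radius i)%:C)%C * y)).
Proof.
move=> <- [_ Xz] y1.
apply: (Xz a (disc_centre a y, disc_radius a, sc (circle_of a).1.1)).
by apply/mapP; exists y => //; rewrite mem_roots_seq y1.
Qed.

Definition bump_factor (j : J * bool) (r : nat) (z : C) : C :=
  let a := pickle (j, r) in
  let g := circle_factor (cen j.1) (radius (j, r)) (2 ^ exponent a) z in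
  if j.2 then g else 1 - g.

Let g_factor j r := circle_factor (cen j.1) (radius (j, r)) (2 ^ exponent (pickle (j, r))).

Let factor_approx (j : J * bool) r (z : C) :
  (normc (z - cen j.1) <= inner_radius (j, r) ->
     normc (g_factor j r z - 1) <= error_budget (factor_bound j) r) /\
  (outer_radius (j, r) <= normc (z - cen j.1) ->
     normc (g_factor j r z) <= error_budget (factor_bound j) r).
Proof.
exact: (exponentP z (circle_ofK (j, r))).
Qed.

Let factor_pole (j : J * bool) r (z : C) : X_cheese z ->
  1 - ((z - cen j.1) / ((radius (j, r))%:C)%C) ^+ (2 ^ exponent (pickle (j, r))) != 0 /\
  normc (g_factor j r z) <= 2 / thickness (pickle (j, r)).
Proof.
move=> Xz; have [k0 k1 _ _ _] := thicknessP (pickle (j, r)).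
apply: circle_factor_bound => //; first exact: radius_gt0.
by move=> y; exact: (X_disc_far (circle_ofK (j, r)) Xz).
Qed.

Let bump_factor_le j r (z : C) : X_cheese z -> normc (bump_factor j r z) <= factor_bound j r.
Proof.
move=> /(factor_pole j r) [_ gb]; rewrite /bump_factor /factor_bound -/(g_factor j r z).
case: ifP => _; first by rewrite (le_trans gb)// lerDl.
by apply: le_trans (ler_modB _ _) _; rewrite mod1 addrC lerD2r.
Qed.

Let bump_factor_near1 j r (z : C) :
  (if j.2 then normc (z - cen j.1) <= inner_radius (j, r)
   else outer_radius (j, r) <= normc (z - cen j.1)) ->
  normc (bump_factor j r z - 1) <= error_budget (factor_bound j) r.
Proof.
have [h1 h2] := factor_approx j r z.
rewrite /bump_factor -/(g_factor j r z); case: ifP => _; first exact: h1.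
by rewrite addrAC subrr add0r modN; exact: h2.
Qed.

Let bump_factor_near0 j r (z : C) :
  (if j.2 then outer_radius (j, r) <= normc (z - cen j.1)
   else normc (z - cen j.1) <= inner_radius (j, r)) ->
  normc (bump_factor j r z) <= error_budget (factor_bound j) r.
Proof.
have [h1 h2] := factor_approx j r z.
rewrite /bump_factor -/(g_factor j r z); case: ifP => _; first exact: h2.
by rewrite (modB 1); exact: h1.
Qed.

(** Off the annulus between its inner and its outer radius, each factor is close to
    the indicator function of the disc bounded by its circle if the circles
    increase, and of the complement of this disc if they decrease.  The annuli of
    two consecutive factors do not overlap, which gives the dichotomy required by
    [product_limit]. *)
Lemma bump_exists (j : J * bool) : exists F : C -> C,
  [/\ RX X_cheese F,
      forall z : C, X_cheese z ->
        (if j.2 then sc j.1 <= normc (z - cen j.1)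
         else normc (z - cen j.1) <= sc j.1 / 2) -> F z = 0 &
      forall z : C, X_cheese z ->
        (if j.2 then normc (z - cen j.1) <= sc j.1 / 4
         else sc j.1 <= normc (z - cen j.1)) -> F z != 0].
Proof.
have s0 := sc_gt0 j.1.
have small n (z : C) : X_cheese z ->
    normc (bump_factor j n.+1 z - 1) <= error_budget (factor_bound j) n.+1 \/
    normc (bump_factor j n z) <= error_budget (factor_bound j) n.
  move=> _; case: (boolP j.2) => j2.
    have E : inner_radius (j, n.+1) = outer_radius (j, n).
      by rewrite /inner_radius /outer_radius /= j2 half_powS; congr (_ * _); lra.
    have [h|/ltW h] := leP (normc (z - cen j.1)) (outer_radius (j, n)).
      by left; apply: bump_factor_near1; rewrite j2 E.
    by right; apply: bump_factor_near0; rewrite j2.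
  have E : inner_radius (j, n) = outer_radius (j, n.+1).
    by rewrite /inner_radius /outer_radius /= (negbTE j2) half_powS; congr (_ * _); lra.
  have [h|/ltW h] := leP (normc (z - cen j.1)) (inner_radius (j, n)).
    by right; apply: bump_factor_near0; rewrite (negbTE j2).
  by left; apply: bump_factor_near1; rewrite (negbTE j2) -E.
have [F [Flim F0 F1]] := @product_limit R (factor_bound j) (bump_factor j) X_cheese
  (factor_bound_ge0 j) (fun n z Xz => bump_factor_le j n Xz) small.
have x0 := half_pow_gt0; have x1 := half_pow_le1.
exists F; split.
- apply: RX_of_uniform_limit => e e0.
  have [n ne] : exists n, half_pow n <= e by apply: expr_small => //; lra.
  have rat r : rational_on X_cheese (bump_factor j r).
    have [|r1 r2] := @rational_on_factor R X_cheese (cen j.1) (radius (j, r))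
      (2 ^ exponent (pickle (j, r))).
      by move=> z Xz; exact: (factor_pole j r Xz).1.
    case j2 : j.2.
      by move: r1; congr rational_on; apply/funext => z; rewrite /bump_factor j2.
    by move: r2; congr rational_on; apply/funext => z; rewrite /bump_factor j2.
  have [p [q [q0 pq]]] := rational_on_prod rat n.+1.
  exists p, q; split => // z Xz; rewrite -pq//.
  apply: le_lt_trans (Flim n z Xz) _.
  rewrite exprD -/(half_pow n) !exprS expr0; have := x0 n; lra.
- move=> z Xz hz; apply: F0 => // n; apply: bump_factor_near0.
  rewrite /outer_radius /inner_radius /=; have := x0 n.
  case: ifP hz => _ hz h; [apply: le_trans hz|apply: le_trans hz _].
    by rewrite ler_piMr ?(ltW s0)//; lra.
  by rewrite ler_pM2l//; lra.
- move=> z Xz hz; apply: F1 => // n; apply: bump_factor_near1.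
  rewrite /outer_radius /inner_radius /=; have := x0 n; have := x1 n.
  case: ifP hz => _ hz h1 h0; [apply: le_trans hz _|apply: le_trans hz].
    by rewrite ler_pM2l//; lra.
  by rewrite ler_piMr ?(ltW s0)//; lra.
Qed.

(** For a small disc of the family around x, the function of the increasing circles
    vanishes near any other point y and not at x; for the decreasing circles it
    vanishes near x and is not zero at y. *)
Lemma X_regular (x : C) : (X_cheese `\` K) x ->
  point_of_continuity X_cheese x /\ R_point X_cheese x.
Proof.
move=> [Xx nKx]; split; split => // y [Xy /= /eqP yx] sub.
  have xy : 0 < normc (x - y) / 2 by rewrite divr_gt0// mod_gt0 subr_eq0 eq_sym.
  have [i [xi si]] := fine nKx xy; have s0 := sc_gt0 i.
  have [F [FR F0 F1]] := bump_exists (i, true).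
  have s2 : 0 < sc i / 2 by rewrite divr_gt0.
  have /sub [_ Fx] : ideal_J X_cheese y F.
    split => //; apply: (@interior_subspace R X_cheese _ y (sc i / 2) Xy s2).
    move=> w wy Xw; apply: F0 => //=.
    have h1 := ler_mod_dist (cen i) x y; have h2 := ler_mod_dist w (cen i) y.
    rewrite [in normc (cen i - w)]modB in h2.
    by lra.
  by have := F1 x Xx xi; rewrite Fx eqxx.
have xy : 0 < normc (x - y) / 2 by rewrite divr_gt0// mod_gt0 subr_eq0 eq_sym.
have [i [xi si]] := fine nKx xy; have s0 := sc_gt0 i.
have [F [FR F0 F1]] := bump_exists (i, false).
have s4 : 0 < sc i / 4 by rewrite divr_gt0.
have /sub [_ Fy] : ideal_J X_cheese x F.
  split => //; apply: (@interior_subspace R X_cheese _ x (sc i / 4) Xx s4).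
  move=> w wx Xw; apply: F0 => //=.
  have h1 := ler_mod_dist x w (cen i); lra.
have : F y != 0.
  apply: F1 => //=; have h1 := ler_mod_dist (cen i) x y.
  by rewrite [in normc (cen i - y)]modB in h1; lra.
by rewrite Fy eqxx.
Qed.

Lemma X_quasianalytic (a b : C) (f : C -> C) : a != b ->
  closed_segment a b `<=` K -> RX X_cheese f ->
  let I := closed_segment a b in
  infinitely_differentiable_on I f /\
  (\sum_(1 <= k <oo) 1 / (sup_norm I (segment_derivn I k f) `^ (k%:R^-1)) = +oo)%E.
Proof.
move=> ab IK fR I.
have [F [M [M0 F0 FM FT]]] := RX_smooth eta_gt0 eta_lt1 block_gt0 block_delta_gt0
  block_far K_in family_small family_thin family_weight K_sub_cheese fR.
have [fd dE] := @smooth_on_segment R a b f F _ ab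
  (fun z Iz => F0 z (IK z Iz)) (fun k z w Iz Iw => FT k z w (IK z Iz) (IK w Iw)).
split => //.
have ei : 0 < eta^-1 by rewrite invr_gt0.
have [M1 M10 hM1] := geometric_le_harmonic ei.
pose A := Num.max 1 (M * (M1 + 1)).
have aI : I a.
  exists 0; first by rewrite /= in_itv /= lexx ler01.
  by rewrite subr0 rmorph1 rmorph0 mul1r mul0r addr0.
apply: (@denjoy_carleman_sum R _ A); first by rewrite le_max lexx.
- move=> k; apply: (@le_trans _ _ (normc (segment_derivn I k f a))%:E).
    by rewrite lee_fin mod_ge0.
  by apply: ereal_sup_ubound; exists a.
- move=> k; apply: ge_ereal_sup => _ [z Iz <-]; rewrite lee_fin dE//.
  apply: le_trans (FM k z (IK z Iz)) _.
  have hk := harmonic_sum_expn_gt0 R k.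
  have wk : cheese_weight eta (fun n => harmonic_sum R n ^+ n) k <=
      (M1 + 1) * harmonic_sum R k ^+ k.
    by rewrite /cheese_weight mulrDl mul1r lerD2r hM1.
  apply: (@le_trans _ _ (k`!%:R * M * ((M1 + 1) * harmonic_sum R k ^+ k))).
    by rewrite ler_wpM2l// mulr_ge0.
  have -> : k`!%:R * M * ((M1 + 1) * harmonic_sum R k ^+ k) =
    M * (M1 + 1) * (k`!%:R * harmonic_sum R k ^+ k) by ring.
  rewrite -[leRHS]mulrA ler_wpM2r ?mulr_ge0 ?(ltW hk)//.
  by rewrite le_max lexx orbT.
Qed.

End construction.

(* On \bar R, 0^-1 = +oo, which is the convention 1/0 = oo. *)
Theorem theorem4p5 (R : realType) (K : set (Cplx R))
    (cptK : compact K) (subK : K `<=` open_disc 0 1) :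
  exists X : set (Cplx R),
    [/\ swiss_cheese_set X,
        K `<=` X,
        forall x, (X `\` K) x -> point_of_continuity X x /\ R_point X x &
        forall a b : Cplx R, a != b -> closed_segment a b `<=` K ->
        forall f : Cplx R -> Cplx R, RX X f ->
          let I := closed_segment a b in
          infinitely_differentiable_on I f /\
          (\sum_(1 <= k <oo)
             1 / (sup_norm I (segment_derivn I k f) `^ (k%:R^-1)) = +oo)%E].
Proof.
have clK : closed K by apply: compact_closed => //; exact: mod_hausdorff.
have [K0|/set0P K0] := eqVneq K set0; last first.
  have [eta [eta0 eta1 K_in]] := compact_mod_lt1 cptK subK.
  have [cen [sc [sc0 K_far fine]]] := disc_family clK subK.
  exists (X_cheese cen eta0 sc0); split.
  - exact: X_swiss_cheese K_far.
  - exact: K_sub_cheese K_far.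
  - by move=> x; exact: X_regular.
  - move=> a b ab IK f fR; exact: (X_quasianalytic eta1 K_in K_far ab IK fR).
(* For the empty set, X is a single point: the closed unit disc minus an open disc
   which is internally tangent to it. *)
pose X : set (Cplx R) := closed_disc 0 1 `\` \bigcup_(n : nat) open_disc 1 2.
have XE z : X z -> z = -1.
  move=> [z1 z2]; rewrite /closed_disc /= subr0 in z1.
  have {}z2 : 2 <= normc (z - 1).
    by rewrite leNgt; apply/negP => h; apply: z2; exists 0%N.
  case: z z1 z2 => x y /= z1 z2.
  have n1 : x ^+ 2 + y ^+ 2 <= 1.
    by have := z1; rewrite -[X in _ <= X]sqrtr1 ler_psqrt ?qualifE/= ?addr_ge0 ?sqr_ge0.
  have n2 : 4 <= (x - 1) ^+ 2 + (y - 0) ^+ 2.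
    have := z2; rewrite -(@ler_pXn2r _ 2)// ?nnegrE ?sqrtr_ge0// sqr_sqrtr ?addr_ge0 ?sqr_ge0//.
    by apply: le_trans; lra.
  have xE : x = -1 by nra.
  have yE : y = 0 by subst x; nra.
  by rewrite xE yE; apply/eqP; rewrite eq_complex /= oppr0 !eqxx.
have Xm1 : X (-1).
  split; first by rewrite /closed_disc /mkset subr0 modN mod1.
  move=> [n _]; rewrite /open_disc /mkset -opprD modN.
  by rewrite (_ : 1 + 1 = 2%:R)// mod_nat ltxx.
have noK z : ~ K z by rewrite K0.
exists X; split.
- split; last by exists 0, 1, (fun=> 1), (fun=> 2); split.
  split; first by exists (-1).
  have -> : X = [set -1]; last exact: compact_set1.
  by apply/seteqP; split => [z /XE|z ->].
- by rewrite K0; exact: sub0set.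
- move=> x [Xx _]; split; split => // y [/XE yE /= nyx].
    by exfalso; apply: nyx; rewrite yE (XE _ Xx).
  by exfalso; apply: nyx; rewrite yE (XE _ Xx).
- move=> a b _ IK; exfalso; apply: (noK a); apply: IK.
  exists 0; first by rewrite /= in_itv /= lexx ler01.
  by rewrite subr0 rmorph1 rmorph0 mul1r mul0r addr0.
Qed.
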